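(* Consider a path $(J_1,\dots,J_n)\colon A_0\nrightarrow A_n$ of $n\ge1$ (locally discrete) split two-sided $2$-fibrations $J_m=[A_{m-1}\xleftarrow{p_m}J_m\xrightarrow{q_m}A_m]$ and $2$-functors $f\colon A_0\to C$, $g\colon A_n\to C$. Any lax natural transformation $\phi\colon f\circ p_1\circ\pi_{J_1}\Rightarrow g\circ q_n\circ\pi_{J_n}$ of $2$-functors $\prod\underline J=J_1\times_{A_1}\cdots\times_{A_{n-1}}J_n\to C$ satisfies: (poc) $\phi_{(\alpha_!s_1,s_2,\dots,s_n)}=\phi_{(s_1,\dots,s_n)}\odot(\phi_{(j_1,\dots,j_n)}\circ f\alpha)$ for any morphism $(s_1,\dots,s_n)$ with target $(j_1,\dots,j_n)$ in $\prod\underline J$ and $\alpha\colon p_1s_1\Rightarrow u$ in $A_0$; (iec) for any $1\le m<n$, morphisms $(s_1,\dots,s_m)$ in $\prod(J_1,\dots,J_m)$ and $(s_{m+1},\dots,s_n)$ in $\prod(J_{m+1},\dots,J_n)$, and $\alpha\colon p_{m+1}s_{m+1}\Rightarrow q_ms_m$ in $A_m$, the lax naturality cells $\phi_{(s_1,\dots,s_{m-1},\alpha^*s_m,s_{m+1},s_{m+2},\dots,s_n)}$ and $\phi_{(s_1,\dots,s_{m-1},s_m,\alpha_!s_{m+1},s_{m+2},\dots,s_n)}$ are equal; (pcc) $\phi_{(s_1,\dots,s_{n-1},\alpha^*s_n)}=(g\alpha\circ\phi_{(i_1,\dots,i_n)})\odot\phi_{(s_1,\dots,s_n)}$ for any morphism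 $(s_1,\dots,s_n)$ with source $(i_1,\dots,i_n)$ in $\prod\underline J$ and $\alpha\colon u\Rightarrow q_ns_n$ in $A_n$. Moreover nullary cells $\underline J\Rightarrow C$ along $f$ and $g$ in $\mathsf{SpTwo2Fib}$ (respectively $\mathsf{SpTwo2Fib}_{\mathrm{ld}}$) correspond precisely to such lax natural transformations $\phi$ satisfying the following additional conditions: (cm) $\phi_{(u^*i_1,i_2,\dots,i_n)}=\phi_{(i_1,\dots,i_n)}\circ fu$ for any object $(i_1,\dots,i_n)$ of $\prod\underline J$ and $u\colon a\to p_1i_1$ in $A_0$, and the lax naturality cell $\phi_{(\lambda_{p_1}(u,i_1),\mathrm{id}_{i_2},\dots,\mathrm{id}_{i_n})}$ is an identity cell; (im) for any $1\le m<n$, objects $(i_1,\dots,i_m)$ in $\prod(J_1,\dots,J_m)$ and $(i_{m+1},\dots,i_n)$ in $\prod(J_{m+1},\dots,J_n)$, and $u\colon q_mi_m\to p_{m+1}i_{m+1}$ in $A_m$, the components $\phi_{(i_1,\dots,i_m,u^*i_{m+1},i_{m+2},\dots,i_n)}$ and $\phi_{(i_1,\dots,i_{m-1},u_!i_m,i_{m+1},\dots,i_n)}$ are equal and the lax naturality cell $\phi_{(\mathrm{id}_{i_1},\dots,\mathrm{id}_{i_{m-1}},\rho_{q_m}(i_m,u),\lambda_{p_{m+1}}(u,i_{m+1}),\mathrm{id}_{i_{m+2}},\dots,\mathrm{id}_{i_n})}$ is an identity cell; (om) $\phi_{(i_1,\dots,i_{n-1},u_!i_n)}=gu\circ\phi_{(i_1,\dots,i_n)}$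 for any object $(i_1,\dots,i_n)$ of $\prod\underline J$ and $u\colon q_ni_n\to a$ in $A_n$, and the lax naturality cell $\phi_{(\mathrm{id}_{i_1},\dots,\mathrm{id}_{i_{n-1}},\rho_{q_n}(i_n,u))}$ is an identity cell.
   Context: All $2$-categories are large. $\odot$ denotes composition of cells along a morphism, in diagrammatic order; $\circ$ denotes composition of morphisms, horizontal composition and whiskering. All pullbacks are strict. A lax natural transformation $\phi\colon f\Rightarrow g$ of $2$-functors $A\to C$ has components $\phi_x\colon fx\to gx$ and naturality cells $\phi_s\colon gs\circ\phi_x\Rightarrow\phi_y\circ fs$ for $s\colon x\to y$, natural in cells of $A$ and compatible with identities and composition. **Lax arrow $2$-category.** $A^{\mathbf 2}$ has objects $(a,u,b)$ with $u\colon a\to b$; morphisms $(s,\zeta,t)\colon(a_0,u_0,b_0)\to(a_1,u_1,b_1)$ with $s\colon a_0\to a_1$, $t\colon b_0\to b_1$, $\zeta\colon t\circ u_0\Rightarrow u_1\circ s$; cells $(\sigma\colon s_0\Rightarrow s_1,\tau\colon t_0\Rightarrow t_1)$ with $\zeta_0\odot(u_1\circ\sigma)=(\tau\circ u_0)\odot\zeta_1$; projections $\mathrm{src},\mathrm{tgt}\colon A^{\mathbf 2}\to A$. Unit $\tilde\alpha\colon A\to A^{\mathbf 2}$: $a\mapsto(a,\mathrm{id}_a,a)$, $s\mapsto(s,\mathrm{id}_s,s)$, $\sigma\mapsto(\sigma,\sigma)$. Composition $\bar\alpha\colon A^{\mathbf 2}\times_AA^{\mathbf 2}\to A^{\mathbf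 2}$: $(a,u,b,v,c)\mapsto(a,v\circ u,c)$, $(r,\zeta,s,\eta,t)\mapsto(r,(\eta\circ u_0)\odot(v_1\circ\zeta),t)$, $(\rho,\sigma,\tau)\mapsto(\rho,\tau)$. A $2$-functor $f\colon A\to C$ induces $f^{\mathbf 2}\colon A^{\mathbf 2}\to C^{\mathbf 2}$ entrywise. $2$-functors $\phi\colon X\to C^{\mathbf 2}$ with $\mathrm{src}\circ\phi=s$, $\mathrm{tgt}\circ\phi=t$ correspond bijectively to lax natural transformations $s\Rightarrow t$ (component at $x$: the morphism of $C$ given by $\phi x$; naturality cell at $m$: the cell of $C$ given by $\phi m$). **Split two-sided $2$-fibrations.** A split two-sided $2$-fibration $J\colon A\nrightarrow B$ is a span $A\xleftarrow{p}J\xrightarrow{q}B$ of $2$-functors with $2$-functors $\lambda\colon A^{\mathbf 2}\times_AJ\to J$ (pullback of $\mathrm{tgt}$ and $p$) and $\rho\colon J\times_BB^{\mathbf 2}\to J$ (pullback of $q$ and $\mathrm{src}$) such that $p\lambda(x,i)=\mathrm{src}\,x$, $q\lambda(x,i)=qi$, $p\rho(i,y)=pi$, $q\rho(i,y)=\mathrm{tgt}\,y$ (on objects, morphisms and cells), $\lambda\circ(\bar\alpha\times\mathrm{id})=\lambda\circ(\mathrm{id}\times\lambda)$, $\lambda\circ(\tilde\alpha p,\mathrm{id}_J)=\mathrm{id}_J$, $\rho\circ(\mathrm{id}\times\bar\beta)=\rho\circ(\rho\times\mathrm{id})$, $\rho\circ(\mathrm{id}_J,\tilde\beta q)=\mathrm{id}_J$,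 $\rho\circ(\lambda\times\mathrm{id})=\lambda\circ(\mathrm{id}\times\rho)$. Associated cleavages ($\lambda_p$ for $p$, $\rho_q$ for $q$): for $v\colon qi\to b$, $v_!i:=\rho(i,(qi,v,b))$ and $\rho_q(i,v):=\rho(\mathrm{id}_i,(\mathrm{id}_{qi},\mathrm{id}_v,v))\colon i\to v_!i$; for $s\colon i\to j$ in $J$ and $\beta\colon u\Rightarrow qs$, $\beta^*s:=\rho(s,(qs,\beta,u))\colon i\to j$ and $\rho_q(\beta,s):=\rho(\mathrm{id}_s,(\mathrm{id}_{qs},\beta))\colon\beta^*s\Rightarrow s$; for $u\colon a\to pi$, $u^*i:=\lambda((a,u,pi),i)$ and $\lambda_p(u,i):=\lambda((u,\mathrm{id}_u,\mathrm{id}_{pi}),\mathrm{id}_i)\colon u^*i\to i$; for $\alpha\colon ps\Rightarrow v$, $\alpha_!s:=\lambda((v,\alpha,ps),s)$ and $\lambda_p(s,\alpha):=\lambda((\alpha,\mathrm{id}_{ps}),\mathrm{id}_s)\colon s\Rightarrow\alpha_!s$. $J$ is locally discrete if every cell $\sigma$ of $J$ with $p\sigma$ and $q\sigma$ identity cells is an identity cell. **Nullary cells.** A nullary cell $\underline J\Rightarrow C$ along $f,g$ in $\mathsf{SpTwo2Fib}$ ($n\ge1$) is a $2$-functor $\phi\colon\prod\underline J\to C^{\mathbf 2}$ with $\mathrm{src}\,\phi=fp_1\pi_{J_1}$, $\mathrm{tgt}\,\phi=gq_n\pi_{J_n}$ satisfying, as equalities of $2$-functors: $\phi(\lambda(x,i_1),i_2,\dots,i_n)=\bar\gamma(f^{\mathbf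 2}x,\phi(i_1,\dots,i_n))$ on $A_0^{\mathbf 2}\times_{A_0}\prod\underline J$; $\phi(i_1,\dots,i_{n-1},\rho(i_n,y))=\bar\gamma(\phi(i_1,\dots,i_n),g^{\mathbf 2}y)$ on $\prod\underline J\times_{A_n}A_n^{\mathbf 2}$; and for $1\le m<n$, $\phi(\dots,\rho(i_m,x),i_{m+1},\dots)=\phi(\dots,i_m,\lambda(x,i_{m+1}),\dots)$ on $\prod(J_1,\dots,J_m)\times_{A_m}A_m^{\mathbf 2}\times_{A_m}\prod(J_{m+1},\dots,J_n)$; here $\bar\gamma$ is the composition of $C^{\mathbf 2}$. $\mathsf{SpTwo2Fib}_{\mathrm{ld}}\subset\mathsf{SpTwo2Fib}$ restricts horizontal morphisms to locally discrete ones, keeping all cells between them. The correspondence in the claim is the one between $2$-functors into $C^{\mathbf 2}$ and lax natural transformations. *)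

(* Defs.v *)
From mathcomp Require Import all_boot.
From Stdlib Require Import ProofIrrelevance FunctionalExtensionality.
From Stdlib Require Import ClassicalEpsilon.

Set Implicit Arguments.
Unset Strict Implicit.
Unset Printing Implicit Defensive.

#[local] Obligation Tactic := idtac.

(* Strict 2-categories are presented with one type for each of the objects,
   the morphisms and the cells, so that equations between morphisms or cells
   whose boundaries agree only propositionally need no transport.  Composites
   take a proof of composability.  The laws of the structures below quantify
   universally over those proofs, which always exist by the earlier laws on
   sources and targets; in definitions of properties they are quantified
   existentially, so that composability is part of what is asserted. *)
Variant level := ob | mor | cell.

(* [mcomp g f] is g \circ f, [hcomp b a] is the horizontal composite b \circ a,
   and [vcomp a b] is the composite a \odot b along a morphism, in
   diagrammatic order. *)
Record twocat := TwoCat {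
  car :> level -> Type;
  dom : car mor -> car ob;
  cod : car mor -> car ob;
  csrc : car cell -> car mor;
  ctgt : car cell -> car mor;
  idm : car ob -> car mor;
  idc : car mor -> car cell;
  mcomp : forall g f : car mor, cod f = dom g -> car mor;
  hcomp : forall b a : car cell, cod (csrc a) = dom (csrc b) -> car cell;
  vcomp : forall a b : car cell, ctgt a = csrc b -> car cell;
  dom_ctgt : forall a, dom (ctgt a) = dom (csrc a);
  cod_ctgt : forall a, cod (ctgt a) = cod (csrc a);
  dom_idm : forall x, dom (idm x) = x;
  cod_idm : forall x, cod (idm x) = x;
  csrc_idc : forall f, csrc (idc f) = f;
  ctgt_idc : forall f, ctgt (idc f) = f;
  dom_comp : forall g f e, dom (@mcomp g f e) = dom f;
  cod_comp : forall g f e, cod (@mcomp g f e) = cod g;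
  csrc_hcomp : forall b a e e',
    csrc (@hcomp b a e) = @mcomp (csrc b) (csrc a) e';
  ctgt_hcomp : forall b a e e',
    ctgt (@hcomp b a e) = @mcomp (ctgt b) (ctgt a) e';
  csrc_vcomp : forall a b e, csrc (@vcomp a b e) = csrc a;
  ctgt_vcomp : forall a b e, ctgt (@vcomp a b e) = ctgt b;
  compif : forall f e, @mcomp (idm (cod f)) f e = f;
  compfi : forall f e, @mcomp f (idm (dom f)) e = f;
  compA : forall h g f e1 e2 e3 e4,
    @mcomp h (@mcomp g f e1) e2 = @mcomp (@mcomp h g e3) f e4;
  vcompia : forall a e, @vcomp (idc (csrc a)) a e = a;
  vcompai : forall a e, @vcomp a (idc (ctgt a)) e = a;
  vcompA : forall a b c e1 e2 e3 e4,
    @vcomp a (@vcomp b c e1) e2 = @vcomp (@vcomp a b e3) c e4;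
  hcompia : forall a e, @hcomp (idc (idm (cod (csrc a)))) a e = a;
  hcompai : forall a e, @hcomp a (idc (idm (dom (csrc a)))) e = a;
  hcompA : forall c b a e1 e2 e3 e4,
    @hcomp c (@hcomp b a e1) e2 = @hcomp (@hcomp c b e3) a e4;
  hcomp_idc : forall g f e e', @hcomp (idc g) (idc f) e = idc (@mcomp g f e');
  interchange : forall b0 b1 a0 a1 e1 e2 e3 e4 e5 e6,
    @vcomp (@hcomp b0 a0 e1) (@hcomp b1 a1 e2) e3 =
    @hcomp (@vcomp b0 b1 e4) (@vcomp a0 a1 e5) e6
}.

Arguments dom {_} _.
Arguments cod {_} _.
Arguments csrc {_} _.
Arguments ctgt {_} _.
Arguments idm {_} _.
Arguments idc {_} _.
Arguments mcomp {_} g f _.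
Arguments hcomp {_} b a _.
Arguments vcomp {_} a b _.

Definition is_idc (C : twocat) (a : C cell) := exists f, a = idc f.

(* The whiskerings g \circ a and a \circ f. *)
Definition lwh (C : twocat) (g : C mor) (a : C cell)
    (e : cod (csrc a) = dom g) : C cell :=
  hcomp (idc g) a (etrans e (esym (congr1 dom (csrc_idc g)))).

Definition rwh (C : twocat) (a : C cell) (f : C mor)
    (e : cod f = dom (csrc a)) : C cell :=
  hcomp a (idc f) (etrans (congr1 cod (csrc_idc f)) e).

Arguments lwh {_} g a _.
Arguments rwh {_} a f _.

Record twofun (A C : twocat) := TwoFun {
  fmap :> forall k, A k -> C k;
  fdom : forall f, dom (fmap f) = fmap (dom f);
  fcod : forall f, cod (fmap f) = fmap (cod f);
  fcsrc : forall a, csrc (fmap a) = fmap (csrc a);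
  fctgt : forall a, ctgt (fmap a) = fmap (ctgt a);
  fidm : forall x, fmap (idm x) = idm (fmap x);
  fidc : forall f, fmap (idc f) = idc (fmap f);
  fcomp : forall g f e e', fmap (mcomp g f e) = mcomp (fmap g) (fmap f) e';
  fhcomp : forall b a e e', fmap (hcomp b a e) = hcomp (fmap b) (fmap a) e';
  fvcomp : forall a b e e', fmap (vcomp a b e) = vcomp (fmap a) (fmap b) e'
}.

Arguments fcomp {A C} F {g f} e e' : rename.
Arguments fhcomp {A C} F {b a} e e' : rename.
Arguments fvcomp {A C} F {a b} e e' : rename.

Lemma comp_eq (C : twocat) (g f g' f' : C mor) e e' :
  g = g' -> f = f' -> mcomp g f e = mcomp g' f' e'.
Proof. by move=> ? ?; subst; rewrite (proof_irrelevance _ e e'). Qed.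

Lemma hcomp_eq (C : twocat) (g f g' f' : C cell) e e' :
  g = g' -> f = f' -> hcomp g f e = hcomp g' f' e'.
Proof. by move=> ? ?; subst; rewrite (proof_irrelevance _ e e'). Qed.

Lemma vcomp_eq (C : twocat) (g f g' f' : C cell) e e' :
  g = g' -> f = f' -> vcomp g f e = vcomp g' f' e'.
Proof. by move=> ? ?; subst; rewrite (proof_irrelevance _ e e'). Qed.

Program Definition twofun_comp (A B C : twocat) (G : twofun B C)
    (F : twofun A B) : twofun A C :=
  @TwoFun A C (fun k x => G k (F k x)) _ _ _ _ _ _ _ _ _.
Next Obligation. by move=> * /=; rewrite !fdom. Qed.
Next Obligation. by move=> * /=; rewrite !fcod. Qed.
Next Obligation. by move=> * /=; rewrite !fcsrc. Qed.
Next Obligation. by move=> * /=; rewrite !fctgt. Qed.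
Next Obligation. by move=> * /=; rewrite !fidm. Qed.
Next Obligation. by move=> * /=; rewrite !fidc. Qed.
Next Obligation.
move=> A B C G F g f e e' /=.
have h : cod (F _ f) = dom (F _ g) by rewrite fcod fdom e.
by rewrite (fcomp F e h) (fcomp G h e').
Qed.
Next Obligation.
move=> A B C G F b a e e' /=.
have h : cod (csrc (F _ a)) = dom (csrc (F _ b))
  by rewrite !fcsrc fcod fdom e.
by rewrite (fhcomp F e h) (fhcomp G h e').
Qed.
Next Obligation.
move=> A B C G F a b e e' /=.
have h : ctgt (F _ a) = csrc (F _ b) by rewrite fctgt fcsrc e.
by rewrite (fvcomp F e h) (fvcomp G h e').
Qed.

Notation "G \of F" := (twofun_comp G F) (at level 40, left associativity).

Record laxnat (A C : twocat) (F G : twofun A C) := LaxNat {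
  lcomp : A ob -> C mor;
  lcell : A mor -> C cell;
  dom_lcomp : forall x, dom (lcomp x) = F ob x;
  cod_lcomp : forall x, cod (lcomp x) = G ob x;
  csrc_lcell : forall s e, csrc (lcell s) = mcomp (G mor s) (lcomp (dom s)) e;
  ctgt_lcell : forall s e, ctgt (lcell s) = mcomp (lcomp (cod s)) (F mor s) e;
  lcell_nat : forall (a : A cell) e1 e2 e3 e4,
    vcomp (rwh (G cell a) (lcomp (dom (csrc a))) e1) (lcell (ctgt a)) e2 =
    vcomp (lcell (csrc a)) (lwh (lcomp (cod (csrc a))) (F cell a) e3) e4;
  lcell_idm : forall x, lcell (idm x) = idc (lcomp x);
  lcell_comp : forall t s e e1 e2 e3,
    lcell (mcomp t s e) =
    vcomp (lwh (G mor t) (lcell s) e1) (rwh (lcell t) (F mor s) e2) e3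
}.

(* The sub-2-category of the objects, morphisms and cells satisfying S. *)
Section SubTwoCat.
Variables (C : twocat) (S : forall k, C k -> Prop).

Record cellclosed : Prop := Closed {
  cl_dom : forall f, @S mor f -> @S ob (dom f);
  cl_cod : forall f, @S mor f -> @S ob (cod f);
  cl_csrc : forall a, @S cell a -> @S mor (csrc a);
  cl_ctgt : forall a, @S cell a -> @S mor (ctgt a);
  cl_idm : forall x, @S ob x -> @S mor (idm x);
  cl_idc : forall f, @S mor f -> @S cell (idc f);
  cl_comp : forall g f e, @S mor g -> @S mor f -> @S mor (mcomp g f e);
  cl_hcomp : forall b a e, @S cell b -> @S cell a -> @S cell (hcomp b a e);
  cl_vcomp : forall a b e, @S cell a -> @S cell b -> @S cell (vcomp a b e)
}.

Hypothesis cS : cellclosed.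

Definition subcar k := {x : C k | S x}.

Lemma subcar_inj k (x y : subcar k) : sval x = sval y -> x = y.
Proof. exact: eq_sig_hprop (fun _ => @proof_irrelevance _) x y. Qed.

Program Definition sub2cat : twocat := @TwoCat subcar
  (fun f => exist _ _ (cl_dom cS (svalP f)))
  (fun f => exist _ _ (cl_cod cS (svalP f)))
  (fun a => exist _ _ (cl_csrc cS (svalP a)))
  (fun a => exist _ _ (cl_ctgt cS (svalP a)))
  (fun x => exist _ _ (cl_idm cS (svalP x)))
  (fun f => exist _ _ (cl_idc cS (svalP f)))
  (fun g f e => exist _ _ (cl_comp cS (congr1 sval e) (svalP g) (svalP f)))
  (fun b a e => exist _ _ (cl_hcomp cS (congr1 sval e) (svalP b) (svalP a)))
  (fun a b e => exist _ _ (cl_vcomp cS (congr1 sval e) (svalP a) (svalP b)))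
  _ _ _ _ _ _ _ _ _ _ _ _ _ _ _ _ _ _ _ _ _ _ _.
Next Obligation. by move=> *; apply: subcar_inj; apply: dom_ctgt. Qed.
Next Obligation. by move=> *; apply: subcar_inj; apply: cod_ctgt. Qed.
Next Obligation. by move=> *; apply: subcar_inj; apply: dom_idm. Qed.
Next Obligation. by move=> *; apply: subcar_inj; apply: cod_idm. Qed.
Next Obligation. by move=> *; apply: subcar_inj; apply: csrc_idc. Qed.
Next Obligation. by move=> *; apply: subcar_inj; apply: ctgt_idc. Qed.
Next Obligation. by move=> *; apply: subcar_inj; apply: dom_comp. Qed.
Next Obligation. by move=> *; apply: subcar_inj; apply: cod_comp. Qed.
Next Obligation. by move=> *; apply: subcar_inj; apply: csrc_hcomp. Qed.
Next Obligation. by move=> *; apply: subcar_inj; apply: ctgt_hcomp. Qed.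
Next Obligation. by move=> *; apply: subcar_inj; apply: csrc_vcomp. Qed.
Next Obligation. by move=> *; apply: subcar_inj; apply: ctgt_vcomp. Qed.
Next Obligation. by move=> *; apply: subcar_inj; apply: compif. Qed.
Next Obligation. by move=> *; apply: subcar_inj; apply: compfi. Qed.
Next Obligation. by move=> *; apply: subcar_inj; apply: compA. Qed.
Next Obligation. by move=> *; apply: subcar_inj; apply: vcompia. Qed.
Next Obligation. by move=> *; apply: subcar_inj; apply: vcompai. Qed.
Next Obligation. by move=> *; apply: subcar_inj; apply: vcompA. Qed.
Next Obligation. by move=> *; apply: subcar_inj; apply: hcompia. Qed.
Next Obligation. by move=> *; apply: subcar_inj; apply: hcompai. Qed.
Next Obligation. by move=> *; apply: subcar_inj; apply: hcompA. Qed.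
Next Obligation. by move=> *; apply: subcar_inj; apply: hcomp_idc. Qed.
Next Obligation. by move=> *; apply: subcar_inj; apply: interchange. Qed.

Definition sub_incl : twofun sub2cat C.
Proof.
refine (@TwoFun sub2cat C (fun k => sval) _ _ _ _ _ _ _ _ _) => //= *.
- exact: comp_eq.
- exact: hcomp_eq.
- exact: vcomp_eq.
Defined.
End SubTwoCat.

Lemma closed_eq (C D : twocat) (F G : twofun C D) :
  cellclosed (fun k (x : C k) => F k x = G k x).
Proof.
split=> [f e|f e|a e|a e|x e|f e|g f h e1 e2|b a h e1 e2|a b h e1 e2].
- by rewrite -!fdom e.
- by rewrite -!fcod e.
- by rewrite -!fcsrc e.
- by rewrite -!fctgt e.
- by rewrite !fidm e.
- by rewrite !fidc e.
- have hF : cod (F _ f) = dom (F _ g) by rewrite fcod fdom h.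
  have hG : cod (G _ f) = dom (G _ g) by rewrite fcod fdom h.
  by rewrite (fcomp F h hF) (fcomp G h hG); apply: comp_eq.
- have hF : cod (csrc (F _ a)) = dom (csrc (F _ b))
    by rewrite !fcsrc fcod fdom h.
  have hG : cod (csrc (G _ a)) = dom (csrc (G _ b))
    by rewrite !fcsrc fcod fdom h.
  by rewrite (fhcomp F h hF) (fhcomp G h hG); apply: hcomp_eq.
- have hF : ctgt (F _ a) = csrc (F _ b) by rewrite fctgt fcsrc h.
  have hG : ctgt (G _ a) = csrc (G _ b) by rewrite fctgt fcsrc h.
  by rewrite (fvcomp F h hF) (fvcomp G h hG); apply: vcomp_eq.
Qed.

Lemma closed_all (C : twocat) (I : Type) (S : I -> forall k, C k -> Prop) :
  (forall i, cellclosed (S i)) -> cellclosed (fun k x => forall i, @S i k x).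
Proof.
move=> cS; split.
- by move=> f h i; apply: cl_dom.
- by move=> f h i; apply: cl_cod.
- by move=> f h i; apply: cl_csrc.
- by move=> f h i; apply: cl_ctgt.
- by move=> f h i; apply: cl_idm.
- by move=> f h i; apply: cl_idc.
- by move=> g f e h h' i; apply: cl_comp.
- by move=> g f e h h' i; apply: cl_hcomp.
- by move=> g f e h h' i; apply: cl_vcomp.
Qed.

Section Products.
Variables (A B : twocat).

Lemma pair_eq (X Y : Type) (z w : X * Y) : z.1 = w.1 -> z.2 = w.2 -> z = w.
Proof. by case: z w => ? ? [? ?] /= -> ->. Qed.

Program Definition prod2 : twocat := @TwoCat (fun k => A k * B k)%type
  (fun f => (dom f.1, dom f.2)) (fun f => (cod f.1, cod f.2))
  (fun a => (csrc a.1, csrc a.2)) (fun a => (ctgt a.1, ctgt a.2))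
  (fun x => (idm x.1, idm x.2)) (fun f => (idc f.1, idc f.2))
  (fun g f e => (mcomp g.1 f.1 (congr1 fst e), mcomp g.2 f.2 (congr1 snd e)))
  (fun b a e => (hcomp b.1 a.1 (congr1 fst e), hcomp b.2 a.2 (congr1 snd e)))
  (fun a b e => (vcomp a.1 b.1 (congr1 fst e), vcomp a.2 b.2 (congr1 snd e)))
  _ _ _ _ _ _ _ _ _ _ _ _ _ _ _ _ _ _ _ _ _ _ _.
Next Obligation. by move=> *; apply: pair_eq; apply: dom_ctgt. Qed.
Next Obligation. by move=> *; apply: pair_eq; apply: cod_ctgt. Qed.
Next Obligation. by move=> *; apply: pair_eq; apply: dom_idm. Qed.
Next Obligation. by move=> *; apply: pair_eq; apply: cod_idm. Qed.
Next Obligation. by move=> *; apply: pair_eq; apply: csrc_idc. Qed.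
Next Obligation. by move=> *; apply: pair_eq; apply: ctgt_idc. Qed.
Next Obligation. by move=> *; apply: pair_eq; apply: dom_comp. Qed.
Next Obligation. by move=> *; apply: pair_eq; apply: cod_comp. Qed.
Next Obligation. by move=> *; apply: pair_eq; apply: csrc_hcomp. Qed.
Next Obligation. by move=> *; apply: pair_eq; apply: ctgt_hcomp. Qed.
Next Obligation. by move=> *; apply: pair_eq; apply: csrc_vcomp. Qed.
Next Obligation. by move=> *; apply: pair_eq; apply: ctgt_vcomp. Qed.
Next Obligation. by move=> *; apply: pair_eq; apply: compif. Qed.
Next Obligation. by move=> *; apply: pair_eq; apply: compfi. Qed.
Next Obligation. by move=> *; apply: pair_eq; apply: compA. Qed.
Next Obligation. by move=> *; apply: pair_eq; apply: vcompia. Qed.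
Next Obligation. by move=> *; apply: pair_eq; apply: vcompai. Qed.
Next Obligation. by move=> *; apply: pair_eq; apply: vcompA. Qed.
Next Obligation. by move=> *; apply: pair_eq; apply: hcompia. Qed.
Next Obligation. by move=> *; apply: pair_eq; apply: hcompai. Qed.
Next Obligation. by move=> *; apply: pair_eq; apply: hcompA. Qed.
Next Obligation. by move=> *; apply: pair_eq; apply: hcomp_idc. Qed.
Next Obligation. by move=> *; apply: pair_eq; apply: interchange. Qed.

Definition prod2_fst : twofun prod2 A.
Proof.
refine (@TwoFun prod2 A (fun k => fst) _ _ _ _ _ _ _ _ _) => //= *.
- exact: comp_eq.
- exact: hcomp_eq.
- exact: vcomp_eq.
Defined.

Definition prod2_snd : twofun prod2 B.
Proof.
refine (@TwoFun prod2 B (fun k => snd) _ _ _ _ _ _ _ _ _) => //= *.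
- exact: comp_eq.
- exact: hcomp_eq.
- exact: vcomp_eq.
Defined.
End Products.

Section BigProduct.
Variables (I : Type) (X : I -> twocat).

Let app i (Y : I -> Type) : (forall i, Y i) -> Y i := fun f => f i.

Let fun_eq (Y : I -> Type) (f g : forall i, Y i) : (forall i, f i = g i) -> f = g
  := @functional_extensionality_dep I Y f g.

Program Definition bigprod : twocat := @TwoCat (fun k => forall i, X i k)
  (fun f i => dom (f i)) (fun f i => cod (f i))
  (fun a i => csrc (a i)) (fun a i => ctgt (a i))
  (fun x i => idm (x i)) (fun f i => idc (f i))
  (fun g f e i => mcomp (g i) (f i) (congr1 (@app i _) e))
  (fun b a e i => hcomp (b i) (a i) (congr1 (@app i _) e))
  (fun a b e i => vcomp (a i) (b i) (congr1 (@app i _) e))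
  _ _ _ _ _ _ _ _ _ _ _ _ _ _ _ _ _ _ _ _ _ _ _.
Next Obligation. by move=> *; apply: fun_eq => i; apply: dom_ctgt. Qed.
Next Obligation. by move=> *; apply: fun_eq => i; apply: cod_ctgt. Qed.
Next Obligation. by move=> *; apply: fun_eq => i; apply: dom_idm. Qed.
Next Obligation. by move=> *; apply: fun_eq => i; apply: cod_idm. Qed.
Next Obligation. by move=> *; apply: fun_eq => i; apply: csrc_idc. Qed.
Next Obligation. by move=> *; apply: fun_eq => i; apply: ctgt_idc. Qed.
Next Obligation. by move=> *; apply: fun_eq => i; apply: dom_comp. Qed.
Next Obligation. by move=> *; apply: fun_eq => i; apply: cod_comp. Qed.
Next Obligation. by move=> *; apply: fun_eq => i; apply: csrc_hcomp. Qed.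
Next Obligation. by move=> *; apply: fun_eq => i; apply: ctgt_hcomp. Qed.
Next Obligation. by move=> *; apply: fun_eq => i; apply: csrc_vcomp. Qed.
Next Obligation. by move=> *; apply: fun_eq => i; apply: ctgt_vcomp. Qed.
Next Obligation. by move=> *; apply: fun_eq => i; apply: compif. Qed.
Next Obligation. by move=> *; apply: fun_eq => i; apply: compfi. Qed.
Next Obligation. by move=> *; apply: fun_eq => i; apply: compA. Qed.
Next Obligation. by move=> *; apply: fun_eq => i; apply: vcompia. Qed.
Next Obligation. by move=> *; apply: fun_eq => i; apply: vcompai. Qed.
Next Obligation. by move=> *; apply: fun_eq => i; apply: vcompA. Qed.
Next Obligation. by move=> *; apply: fun_eq => i; apply: hcompia. Qed.
Next Obligation. by move=> *; apply: fun_eq => i; apply: hcompai. Qed.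
Next Obligation. by move=> *; apply: fun_eq => i; apply: hcompA. Qed.
Next Obligation. by move=> *; apply: fun_eq => i; apply: hcomp_idc. Qed.
Next Obligation. by move=> *; apply: fun_eq => i; apply: interchange. Qed.

Definition bigprod_proj (i : I) : twofun bigprod (X i).
Proof.
refine (@TwoFun bigprod (X i) (fun k (f : bigprod k) => f i) _ _ _ _ _ _ _ _ _)
  => //= *.
- exact: comp_eq.
- exact: hcomp_eq.
- exact: vcomp_eq.
Defined.
End BigProduct.

Section Pullback.
Variables (A B D : twocat) (F : twofun A D) (G : twofun B D).

Definition pb : twocat :=
  sub2cat (closed_eq (F \of prod2_fst A B) (G \of prod2_snd A B)).

Definition pbpair k (x : A k) (y : B k) (e : F k x = G k y) : pb k :=
  exist _ (x, y) e.
End Pullback.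

(* Total versions of the three compositions, used only inside proofs. *)
Module Total.
Section Total.
Variable C : twocat.
Implicit Types (f g h : C mor) (a b c : C cell).

Definition cc g f : C mor :=
  match excluded_middle_informative (cod f = dom g) with
  | left e => mcomp g f e | right _ => f end.
Definition hc b a : C cell :=
  match excluded_middle_informative (cod (csrc a) = dom (csrc b)) with
  | left e => hcomp b a e | right _ => a end.
Definition vc a b : C cell :=
  match excluded_middle_informative (ctgt a = csrc b) with
  | left e => vcomp a b e | right _ => a end.

Lemma ccE g f e : mcomp g f e = cc g f.
Proof. by rewrite /cc; case: excluded_middle_informative => // ?; apply: comp_eq. Qed.
Lemma hcE b a e : hcomp b a e = hc b a.
Proof. by rewrite /hc; case: excluded_middle_informative => // ?; apply: hcomp_eq. Qed.
Lemma vcE a b e : vcomp a b e = vc a b.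
Proof. by rewrite /vc; case: excluded_middle_informative => // ?; apply: vcomp_eq. Qed.
Lemma lwhE g a e : lwh g a e = hc (idc g) a.
Proof. exact: hcE. Qed.
Lemma rwhE a f e : rwh a f e = hc a (idc f).
Proof. exact: hcE. Qed.

Lemma dom_cc g f : cod f = dom g -> dom (cc g f) = dom f.
Proof. by move=> e; rewrite -(ccE e) dom_comp. Qed.
Lemma cod_cc g f : cod f = dom g -> cod (cc g f) = cod g.
Proof. by move=> e; rewrite -(ccE e) cod_comp. Qed.
Lemma csrc_hc b a :
  cod (csrc a) = dom (csrc b) -> csrc (hc b a) = cc (csrc b) (csrc a).
Proof. by move=> e; rewrite -(hcE e) (csrc_hcomp e e) ccE. Qed.
Lemma ctgt_hc b a :
  cod (csrc a) = dom (csrc b) -> ctgt (hc b a) = cc (ctgt b) (ctgt a).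
Proof.
move=> e; have e' : cod (ctgt a) = dom (ctgt b) by rewrite cod_ctgt dom_ctgt.
by rewrite -(hcE e) (ctgt_hcomp e e') ccE.
Qed.
Lemma csrc_vc a b : ctgt a = csrc b -> csrc (vc a b) = csrc a.
Proof. by move=> e; rewrite -(vcE e) csrc_vcomp. Qed.
Lemma ctgt_vc a b : ctgt a = csrc b -> ctgt (vc a b) = ctgt b.
Proof. by move=> e; rewrite -(vcE e) ctgt_vcomp. Qed.

Lemma ccif f x : cod f = x -> cc (idm x) f = f.
Proof.
move=> <-; have e : cod f = dom (idm (cod f)) by rewrite dom_idm.
by rewrite -(ccE e) compif.
Qed.
Lemma ccfi f x : dom f = x -> cc f (idm x) = f.
Proof.
move=> <-; have e : cod (idm (dom f)) = dom f by rewrite cod_idm.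
by rewrite -(ccE e) compfi.
Qed.
Lemma ccA h g f :
  cod f = dom g -> cod g = dom h -> cc h (cc g f) = cc (cc h g) f.
Proof.
move=> e1 e3; have e2 : cod (mcomp g f e1) = dom h by rewrite cod_comp.
have e4 : cod f = dom (mcomp h g e3) by rewrite dom_comp.
by rewrite -(ccE e1) -(ccE e3) -(ccE e2) -(ccE e4); apply: compA.
Qed.

Lemma vcia a f : csrc a = f -> vc (idc f) a = a.
Proof.
move=> <-; have e : ctgt (idc (csrc a)) = csrc a by rewrite ctgt_idc.
by rewrite -(vcE e) vcompia.
Qed.
Lemma vcai a f : ctgt a = f -> vc a (idc f) = a.
Proof.
move=> <-; have e : ctgt a = csrc (idc (ctgt a)) by rewrite csrc_idc.
by rewrite -(vcE e) vcompai.
Qed.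
Lemma vcA a b c :
  ctgt a = csrc b -> ctgt b = csrc c -> vc a (vc b c) = vc (vc a b) c.
Proof.
move=> e3 e1; have e2 : ctgt a = csrc (vcomp b c e1) by rewrite csrc_vcomp.
have e4 : ctgt (vcomp a b e3) = csrc c by rewrite ctgt_vcomp.
by rewrite -(vcE e1) -(vcE e3) -(vcE e2) -(vcE e4); apply: vcompA.
Qed.

Lemma hcia a x : cod (csrc a) = x -> hc (idc (idm x)) a = a.
Proof.
move=> <-.
have e : cod (csrc a) = dom (csrc (idc (idm (cod (csrc a)))))
  by rewrite csrc_idc dom_idm.
by rewrite -(hcE e) hcompia.
Qed.
Lemma hcai a x : dom (csrc a) = x -> hc a (idc (idm x)) = a.
Proof.
move=> <-.
have e : cod (csrc (idc (idm (dom (csrc a))))) = dom (csrc a)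
  by rewrite csrc_idc cod_idm.
by rewrite -(hcE e) hcompai.
Qed.
Lemma hcA c b a :
  cod (csrc a) = dom (csrc b) -> cod (csrc b) = dom (csrc c) ->
  hc c (hc b a) = hc (hc c b) a.
Proof.
move=> e1 e3.
have e2 : cod (csrc (hcomp b a e1)) = dom (csrc c)
  by rewrite hcE csrc_hc // cod_cc.
have e4 : cod (csrc a) = dom (csrc (hcomp c b e3))
  by rewrite hcE csrc_hc // dom_cc.
by rewrite -(hcE e1) -(hcE e3) -(hcE e2) -(hcE e4); apply: hcompA.
Qed.
Lemma hc_idc g f : cod f = dom g -> hc (idc g) (idc f) = idc (cc g f).
Proof.
move=> e; have e' : cod (csrc (idc f)) = dom (csrc (idc g)) by rewrite !csrc_idc.
by rewrite -(hcE e') -(ccE e) hcomp_idc.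
Qed.
Lemma exch b0 b1 a0 a1 :
  cod (csrc a0) = dom (csrc b0) -> ctgt b0 = csrc b1 -> ctgt a0 = csrc a1 ->
  vc (hc b0 a0) (hc b1 a1) = hc (vc b0 b1) (vc a0 a1).
Proof.
move=> e1 e4 e5.
have e2 : cod (csrc a1) = dom (csrc b1) by rewrite -e4 -e5 dom_ctgt cod_ctgt.
have e3 : ctgt (hcomp b0 a0 e1) = csrc (hcomp b1 a1 e2)
  by rewrite !hcE ctgt_hc // csrc_hc // e4 e5.
have e6 : cod (csrc (vcomp a0 a1 e5)) = dom (csrc (vcomp b0 b1 e4))
  by rewrite !csrc_vcomp.
by rewrite -(hcE e1) -(hcE e2) -(vcE e3) -(vcE e4) -(vcE e5) -(hcE e6);
  apply: interchange.
Qed.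
Lemma hc_vcl f a b : cod (csrc a) = dom f -> ctgt a = csrc b ->
  hc (idc f) (vc a b) = vc (hc (idc f) a) (hc (idc f) b).
Proof.
by move=> e e'; rewrite exch ?vcia ?csrc_idc ?ctgt_idc.
Qed.
Lemma hc_vcr f a b : cod f = dom (csrc a) -> ctgt a = csrc b ->
  hc (vc a b) (idc f) = vc (hc a (idc f)) (hc b (idc f)).
Proof.
by move=> e e'; rewrite exch ?vcia ?csrc_idc ?ctgt_idc.
Qed.
End Total.
End Total.
Import Total.

Ltac tot := repeat first
  [ rewrite [LHS]vcE | rewrite [RHS]vcE | rewrite vcE | rewrite lwhE
  | rewrite rwhE | rewrite hcE | rewrite ccE].

(* The object (a,u,b) of the lax arrow 2-category is given by u alone.  A
   morphism (s,zeta,t) from [adom] to [acod] has s = [aleft], t = [aright] and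
   zeta = [acell]; a cell (sigma,tau) has sigma = [asig] and tau = [atau]. *)
Record amor (A : twocat) := AMor {
  adom : A mor;
  acod : A mor;
  aleft : A mor;
  aright : A mor;
  acell : A cell;
  dom_aleft : dom aleft = dom adom;
  cod_aleft : cod aleft = dom acod;
  dom_aright : cod adom = dom aright;
  cod_aright : cod aright = cod acod;
  csrc_acell : csrc acell = mcomp aright adom dom_aright;
  ctgt_acell : ctgt acell = mcomp acod aleft cod_aleft
}.

Record acel (A : twocat) := ACel {
  asrc : amor A;
  atgt : amor A;
  asig : A cell;
  atau : A cell;
  adom_atgt : adom atgt = adom asrc;
  acod_atgt : acod atgt = acod asrc;
  csrc_asig : csrc asig = aleft asrc;
  ctgt_asig : ctgt asig = aleft atgt;
  csrc_atau : csrc atau = aright asrc;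
  ctgt_atau : ctgt atau = aright atgt;
  acel_law : forall e1 e2 e3 e4,
    vcomp (acell asrc) (lwh (acod asrc) asig e1) e2 =
    vcomp (rwh atau (adom asrc) e3) (acell atgt) e4
}.

Lemma amor_eq A (x y : amor A) : adom x = adom y -> acod x = acod y ->
  aleft x = aleft y -> aright x = aright y -> acell x = acell y -> x = y.
Proof.
case: x => ? ? ? ? ? p1 p2 p3 p4 p5 p6; case: y => ? ? ? ? ? q1 q2 q3 q4 q5 q6.
move=> /= ? ? ? ? ?; subst.
have ? := proof_irrelevance _ p2 q2; have ? := proof_irrelevance _ p3 q3; subst.
by rewrite (proof_irrelevance _ p1 q1) (proof_irrelevance _ p4 q4)
  (proof_irrelevance _ p5 q5) (proof_irrelevance _ p6 q6).
Qed.

Lemma acel_eq A (x y : acel A) : asrc x = asrc y -> atgt x = atgt y ->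
  asig x = asig y -> atau x = atau y -> x = y.
Proof.
case: x => ? ? ? ? p1 p2 p3 p4 p5 p6 p7; case: y => ? ? ? ? q1 q2 q3 q4 q5 q6 q7.
move=> /= ? ? ? ?; subst.
by rewrite (proof_irrelevance _ p1 q1) (proof_irrelevance _ p2 q2)
  (proof_irrelevance _ p3 q3) (proof_irrelevance _ p4 q4)
  (proof_irrelevance _ p5 q5) (proof_irrelevance _ p6 q6)
  (proof_irrelevance _ p7 q7).
Qed.


Lemma dom_arightT A (x : amor A) : dom (aright x) = cod (adom x).
Proof. by rewrite dom_aright. Qed.
Lemma csrc_acellT A (x : amor A) : csrc (acell x) = cc (aright x) (adom x).
Proof. by rewrite csrc_acell ccE. Qed.
Lemma ctgt_acellT A (x : amor A) : ctgt (acell x) = cc (acod x) (aleft x).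
Proof. by rewrite ctgt_acell ccE. Qed.

Ltac bd := solve [
  repeat (first
   [ rewrite dom_ctgt | rewrite cod_ctgt | rewrite dom_idm | rewrite cod_idm
   | rewrite csrc_idc | rewrite ctgt_idc
   | rewrite ccE | rewrite lwhE | rewrite rwhE | rewrite hcE | rewrite vcE
   | rewrite dom_aleft | rewrite cod_aleft | rewrite dom_arightT
   | rewrite cod_aright | rewrite csrc_acellT | rewrite ctgt_acellT
   | rewrite adom_atgt | rewrite acod_atgt
   | rewrite csrc_asig | rewrite ctgt_asig | rewrite csrc_atau
   | rewrite ctgt_atau
   | match goal with H : acod _ = adom _ |- _ => progress rewrite -H end
   | match goal with H : atgt _ = asrc _ |- _ => progress rewrite -H end
   | rewrite dom_cc; [|bd] | rewrite cod_cc; [|bd]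
   | rewrite csrc_hc; [|bd] | rewrite ctgt_hc; [|bd]
   | rewrite csrc_vc; [|bd] | rewrite ctgt_vc; [|bd]
   | rewrite ccif; [|bd] | rewrite ccfi; [|bd]
   | rewrite ccA; [|bd|bd]]); try congruence].

Section Arrow.
Variable A : twocat.
Implicit Types (x y z : amor A) (a b c : acel A).

Lemma acel_lawT a :
  vc (acell (asrc a)) (hc (idc (acod (asrc a))) (asig a)) =
  vc (hc (atau a) (idc (adom (asrc a)))) (acell (atgt a)).
Proof.
have e1 : cod (csrc (asig a)) = dom (acod (asrc a)) by bd.
have e2 : ctgt (acell (asrc a)) = csrc (lwh (acod (asrc a)) (asig a) e1) by bd.
have e3 : cod (adom (asrc a)) = dom (csrc (atau a)) by bd.
have e4 : ctgt (rwh (atau a) (adom (asrc a)) e3) = csrc (acell (atgt a)) by bd.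
by have := acel_law e2 e4; rewrite !vcE lwhE rwhE.
Qed.

Program Definition aidm (u : A mor) : amor A :=
  @AMor A u u (idm (dom u)) (idm (cod u)) (idc u) _ _ _ _ _ _.
Solve Obligations with intros; simpl; bd.

Program Definition acomp y x (e : acod x = adom y) : amor A :=
  @AMor A (adom x) (acod y)
    (mcomp (aleft y) (aleft x) _) (mcomp (aright y) (aright x) _)
    (vcomp (lwh (aright y) (acell x) _) (rwh (acell y) (aleft x) _) _)
    _ _ _ _ _ _.
Solve Obligations with intros; simpl; bd.

Lemma acompE y x e : acell (@acomp y x e) =
  vc (hc (idc (aright y)) (acell x)) (hc (acell y) (idc (aleft x))).
Proof. by rewrite /= vcE lwhE rwhE. Qed.

Program Definition aidc x : acel A :=
  @ACel A x x (idc (aleft x)) (idc (aright x)) _ _ _ _ _ _ _.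
Solve Obligations with intros; simpl; bd.
Next Obligation.
by move=> x *; rewrite !vcE lwhE rwhE !hc_idc ?vcai ?vcia //; bd.
Qed.

Program Definition avcomp a b (e : atgt a = asrc b) : acel A :=
  @ACel A (asrc a) (atgt b) (vcomp (asig a) (asig b) _)
  (vcomp (atau a) (atau b) _) _ _ _ _ _ _ _.
Solve Obligations with intros; simpl; bd.
Next Obligation.
move=> a b e f1 f2 f3 f4; rewrite [LHS]vcE [RHS]vcE lwhE rwhE !vcE.
have h1 : adom (asrc b) = adom (asrc a) by rewrite -e adom_atgt.
have h2 : acod (asrc b) = acod (asrc a) by rewrite -e acod_atgt.
rewrite hc_vcl; [|bd|bd]. rewrite hc_vcr; [|bd|bd]. rewrite vcA; [|bd|bd].
rewrite acel_lawT -vcA; [|bd|bd].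
by have := acel_lawT b; rewrite h1 h2 -e => ->; rewrite vcA //; bd.
Qed.

Program Definition ahcomp b a (e : acod (asrc a) = adom (asrc b)) : acel A :=
  @ACel A (acomp e) (@acomp (atgt b) (atgt a) _) (hcomp (asig b) (asig a) _)
  (hcomp (atau b) (atau a) _) _ _ _ _ _ _ _.
Solve Obligations with intros; simpl; bd.
Next Obligation.
move=> b a e f1 f2 f3 f4.
rewrite [LHS]vcE [RHS]vcE !lwhE !rwhE !hcE !acompE /=.
have L : vc (hc (acell (asrc b)) (idc (aleft (asrc a))))
    (hc (idc (acod (asrc b))) (hc (asig b) (asig a))) =
  vc (hc (atau b) (hc (idc (acod (asrc a))) (asig a)))
    (hc (acell (atgt b)) (idc (aleft (atgt a)))).
  rewrite hcA; [|bd|bd]. rewrite exch; [|bd|bd|bd].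
  rewrite acel_lawT vcia; [|bd]. rewrite -[asig a in LHS](vcai (ctgt_asig a)).
  rewrite -exch; [|bd|bd|bd]. by rewrite e hcA //; bd.
have R : vc (hc (idc (aright (asrc b))) (acell (asrc a)))
    (hc (atau b) (hc (idc (acod (asrc a))) (asig a))) =
  vc (hc (hc (atau b) (atau a)) (idc (adom (asrc a))))
    (hc (idc (aright (atgt b))) (acell (atgt a))).
  rewrite exch; [|bd|bd|bd]. rewrite acel_lawT vcia; [|bd].
  rewrite -[atau b in LHS](vcai (ctgt_atau b)).
  rewrite -exch; [|bd|bd|bd]. by rewrite hcA //; bd.
rewrite -vcA; [|bd|bd]. rewrite L vcA; [|bd|bd]. rewrite R -vcA //; bd.
Qed.

Lemma acompif x y e : y = aidm (acod x) -> @acomp y x e = x.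
Proof.
move=> ?; subst; apply: amor_eq => //=.
- by rewrite ccE; clear e; bd.
- by rewrite ccE; clear e; bd.
- by rewrite vcE lwhE rwhE; clear e; rewrite hcia ?hc_idc ?vcai //; bd.
Qed.

Lemma acompfi x y e : y = aidm (adom x) -> @acomp x y e = x.
Proof.
move=> ?; subst; apply: amor_eq => //=.
- by rewrite ccE; clear e; bd.
- by rewrite ccE; clear e; bd.
- by rewrite vcE lwhE rwhE; clear e; rewrite hcai ?hc_idc ?vcia //; bd.
Qed.

Lemma acompA z y x e1 e2 e3 e4 :
  @acomp z (@acomp y x e1) e2 = @acomp (@acomp z y e3) x e4.
Proof.
simpl in *; apply: amor_eq => //=; try bd.
tot.
rewrite hc_vcl; [|bd|bd]. rewrite hc_vcr; [|bd|bd].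
rewrite -!hc_idc; [|bd|bd]. rewrite -vcA; [|bd|bd].
by rewrite !hcA //; bd.
Qed.

Lemma acomp_eq y x e y' x' e' : y = y' -> x = x' -> @acomp y x e = @acomp y' x' e'.
Proof. by move=> ? ?; subst; rewrite (proof_irrelevance _ e e'). Qed.

Definition arrcar (k : level) : Type :=
  match k with ob => A mor | mor => amor A | cell => acel A end.

Program Definition arr : twocat := @TwoCat arrcar
  (@adom A) (@acod A) (@asrc A) (@atgt A) aidm aidc acomp ahcomp avcomp
  _ _ _ _ _ _ _ _ _ _ _ _ _ _ _ _ _ _ _ _ _ _ _.
Next Obligation. exact: adom_atgt. Qed.
Next Obligation. exact: acod_atgt. Qed.
Next Obligation. by []. Qed.
Next Obligation. by []. Qed.
Next Obligation. by []. Qed.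
Next Obligation. by []. Qed.
Next Obligation. by []. Qed.
Next Obligation. by []. Qed.
Next Obligation. by move=> b a e e' /=; rewrite (proof_irrelevance _ e e'). Qed.
Next Obligation.
by move=> b a e e' /=; congr acomp; apply: proof_irrelevance.
Qed.
Next Obligation. by []. Qed.
Next Obligation. by []. Qed.
Next Obligation. by move=> *; apply: acompif. Qed.
Next Obligation. by move=> *; apply: acompfi. Qed.
Next Obligation. by move=> *; apply: acompA. Qed.
Next Obligation.
by move=> a e /=; apply: acel_eq => //=; rewrite vcE; clear e;
  rewrite vcia //; bd.
Qed.
Next Obligation.
by move=> a e /=; apply: acel_eq => //=; rewrite vcE; clear e;
  rewrite vcai //; bd.
Qed.
Next Obligation.
by move=> a b c /= e1 e2 e3 e4; apply: acel_eq => //=; tot; apply: vcA; bd.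
Qed.
Next Obligation.
move=> a e /=; apply: acel_eq => /=.
- exact: acompif.
- by apply: acompif; rewrite acod_atgt.
- by rewrite hcE; clear e; rewrite hcia //; bd.
- by rewrite hcE; clear e; rewrite hcia //; bd.
Qed.
Next Obligation.
move=> a e /=; apply: acel_eq => /=.
- exact: acompfi.
- by apply: acompfi; rewrite adom_atgt.
- by rewrite hcE; clear e; rewrite hcai //; bd.
- by rewrite hcE; clear e; rewrite hcai //; bd.
Qed.
Next Obligation.
move=> c b a /= e1 e2 e3 e4; apply: acel_eq => /=; try exact: acompA.
- by tot; apply: hcA; bd.
- by tot; apply: hcA; bd.
Qed.
Next Obligation.
move=> y x /= e e'; apply: acel_eq => /=; try exact: acomp_eq.
- by tot; rewrite hc_idc //; bd.
- by tot; rewrite hc_idc //; bd.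
Qed.
Next Obligation.
move=> b0 b1 a0 a1 /= e1 e2 e3 e4 e5 e6; apply: acel_eq => /=;
  try exact: acomp_eq.
- by tot; apply: exch; bd.
- by tot; apply: exch; bd.
Qed.

Definition arr_src : twofun arr A.
Proof.
refine (@TwoFun arr A (fun k => match k return arrcar k -> A k with
  ob => @dom A | mor => @aleft A | cell => @asig A end) _ _ _ _ _ _ _ _ _).
- exact: dom_aleft.
- exact: cod_aleft.
- exact: csrc_asig.
- exact: ctgt_asig.
- by [].
- by [].
- by move=> *; apply: comp_eq.
- by move=> *; apply: hcomp_eq.
- by move=> *; apply: vcomp_eq.
Defined.

Definition arr_tgt : twofun arr A.
Proof.
refine (@TwoFun arr A (fun k => match k return arrcar k -> A k with
  ob => @cod A | mor => @aright A | cell => @atau A end) _ _ _ _ _ _ _ _ _).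
- exact: dom_arightT.
- exact: cod_aright.
- exact: csrc_atau.
- exact: ctgt_atau.
- by [].
- by [].
- by move=> *; apply: comp_eq.
- by move=> *; apply: hcomp_eq.
- by move=> *; apply: vcomp_eq.
Defined.

Program Definition amor_of (s : A mor) : amor A :=
  @AMor A (idm (dom s)) (idm (cod s)) s s (idc s) _ _ _ _ _ _.
Solve Obligations with intros; simpl; bd.

Program Definition acel_of (a : A cell) : acel A :=
  @ACel A (amor_of (csrc a)) (amor_of (ctgt a)) a a _ _ _ _ _ _ _.
Solve Obligations with intros; simpl; bd.
Next Obligation.
move=> a /= e1 e2 e3 e4; tot.
by rewrite vcia ?vcai ?hcia ?hcai //; bd.
Qed.

Lemma amor_of_comp g f e e' :
  amor_of (@mcomp A g f e) = @acomp (amor_of g) (amor_of f) e'.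
Proof.
apply: amor_eq => //=.
- by rewrite dom_comp.
- by rewrite cod_comp.
- exact: comp_eq.
- exact: comp_eq.
- by tot; clear e'; rewrite hc_idc // vcia //; bd.
Qed.

Definition arr_unit : twofun A arr.
Proof.
refine (@TwoFun A arr (fun k => match k return A k -> arrcar k with
  ob => idm | mor => amor_of | cell => acel_of end) _ _ _ _ _ _ _ _ _) => //.
- by move=> x; apply: amor_eq => //=; rewrite ?dom_idm ?cod_idm.
- move=> f; apply: acel_eq => //=; by rewrite ?csrc_idc ?ctgt_idc.
- exact: amor_of_comp.
- move=> b a e e'; apply: acel_eq => //=; last exact: hcomp_eq.
  + have e1 : cod (csrc a) = dom (csrc b) by bd.
    have e2 : acod (amor_of (csrc a)) = adom (amor_of (csrc b)) by rewrite /= e1.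
    rewrite (csrc_hcomp e e1) (amor_of_comp e1 e2); exact: acomp_eq.
  + have e1 : cod (ctgt a) = dom (ctgt b) by bd.
    have e2 : acod (amor_of (ctgt a)) = adom (amor_of (ctgt b)) by rewrite /= e1.
    rewrite (ctgt_hcomp e e1) (amor_of_comp e1 e2); exact: acomp_eq.
  + exact: hcomp_eq.
- move=> a b e e'; apply: acel_eq => //=.
  + by rewrite csrc_vcomp.
  + by rewrite ctgt_vcomp.
  + exact: vcomp_eq.
  + exact: vcomp_eq.
Defined.

Notation apb := (pb arr_tgt arr_src).

Lemma abar_dom x y : aright x = aleft y -> cod (adom x) = dom (adom y).
Proof. by move=> e; rewrite dom_aright e dom_aleft. Qed.
Lemma abar_cod x y : aright x = aleft y -> cod (acod x) = dom (acod y).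
Proof. by move=> e; rewrite -cod_aright e cod_aleft. Qed.

Ltac bde := 
  repeat match goal with H : aright _ = aleft _ |- _ =>
    move: (abar_dom H) (abar_cod H) => ? ?; revert H end; intros; bd.

Program Definition abar_mor x y (e : aright x = aleft y) : amor A :=
  @AMor A (mcomp (adom y) (adom x) _) (mcomp (acod y) (acod x) _)
    (aleft x) (aright y)
    (vcomp (rwh (acell y) (adom x) _) (lwh (acod y) (acell x) _) _)
    _ _ _ _ _ _.
Solve Obligations with intros; simpl; bde.

Lemma abarE x y e : acell (@abar_mor x y e) =
  vc (hc (acell y) (idc (adom x))) (hc (idc (acod y)) (acell x)).
Proof. by rewrite /= vcE lwhE rwhE. Qed.

Lemma abar_src a b : atau a = asig b -> aright (asrc a) = aleft (asrc b).
Proof. by move=> e; rewrite -csrc_atau e csrc_asig. Qed.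
Lemma abar_tgt a b : atau a = asig b -> aright (atgt a) = aleft (atgt b).
Proof. by move=> e; rewrite -ctgt_atau e ctgt_asig. Qed.

Program Definition abar_cel a b (e : atau a = asig b) : acel A :=
  @ACel A (abar_mor (abar_src e)) (abar_mor (abar_tgt e)) (asig a) (atau b)
  _ _ _ _ _ _ _.
Solve Obligations with
  intros; simpl; try apply: comp_eq; rewrite ?adom_atgt ?acod_atgt; bd.
Next Obligation.
move=> a b e f1 f2 f3 f4.
have es := abar_src e; have et := abar_tgt e.
have hd := abar_dom es; have hc' := abar_cod es.
rewrite [LHS]vcE [RHS]vcE lwhE rwhE !abarE /= !ccE.
rewrite -!hc_idc; [|bd|bd].
rewrite -vcA; [|bd|bd].
rewrite -hcA; [|bd|bd]. rewrite -hc_vcl; [|bd|bd].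
rewrite acel_lawT hc_vcl; [|bd|bd].
rewrite vcA; [|bd|bd]. rewrite e hcA; [|bd|bd]. rewrite -hc_vcr; [|bd|bd].
rewrite acel_lawT hc_vcr; [|bd|bd].
by rewrite adom_atgt acod_atgt vcA ?hcA //; bd.
Qed.

Lemma abar_mor_eq x y e x' y' e' :
  x = x' -> y = y' -> @abar_mor x y e = @abar_mor x' y' e'.
Proof. by move=> ? ?; subst; rewrite (proof_irrelevance _ e e'). Qed.

Lemma abar_acomp x y x' y' e e' f f' g h :
  @abar_mor (@acomp x' x f) (@acomp y' y f') g =
  @acomp (@abar_mor x' y' e') (@abar_mor x y e) h.
Proof.
have hd := abar_dom e; have hc' := abar_cod e.
have hd' := abar_dom e'; have hc'' := abar_cod e'.
apply: amor_eq => //=; try exact: comp_eq.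
tot. clear g h.
rewrite hc_vcr; [|bd|bd]. rewrite hc_vcl; [|bd|bd].
rewrite hc_vcl; [|bd|bd]. rewrite hc_vcr; [|bd|bd].
have Q : vc (hc (hc (acell y') (idc (aleft y))) (idc (adom x)))
    (hc (idc (acod y')) (hc (idc (aright x')) (acell x))) =
  hc (acell y') (acell x).
  rewrite e' -hcA; [|bd|bd]. rewrite [X in vc _ X = _]hcA; [|bd|bd].
  rewrite hc_idc; [|bd]. rewrite hc_idc; [|bd].
  by rewrite exch ?vcai ?vcia //; bd.
have M : vc (hc (idc (aright y')) (hc (idc (acod y)) (acell x)))
    (hc (hc (acell y') (idc (adom x'))) (idc (aleft x))) =
  hc (acell y') (acell x).
  rewrite hcA; [|bd|bd]. rewrite -[X in vc _ X = _]hcA; [|bd|bd].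
  rewrite hc_idc; [|bd]. rewrite hc_idc; [|bd].
  by rewrite exch ?vcai ?vcia //; bd.
rewrite -vcA; [|bd|bd]. rewrite [X in vc _ X = _]vcA; [|bd|bd].
rewrite Q -[RHS]vcA; [|bd|bd]. rewrite [X in _ = vc _ X]vcA; [|bd|bd].
by rewrite M !hcA //; bd.
Qed.

Definition arr_comp : twofun apb arr.
Proof.
refine (@TwoFun apb arr (fun k => match k return apb k -> arrcar k with
  | ob => fun w => @mcomp A (sval w).2 (sval w).1 (svalP w)
  | mor => fun w => @abar_mor (sval w).1 (sval w).2 (svalP w)
  | cell => fun w => @abar_cel (sval w).1 (sval w).2 (svalP w) end) _ _ _ _ _ _ _ _ _).
- by move=> f; apply: (@comp_eq A).
- by move=> f; apply: (@comp_eq A).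
- by move=> a; apply: abar_mor_eq.
- by move=> a; apply: abar_mor_eq.
- move=> [[u v] e] /=; apply: amor_eq => //=.
  + exact: comp_eq.
  + exact: comp_eq.
  + by rewrite dom_comp.
  + by rewrite cod_comp.
  + by tot; simpl in e; rewrite !hc_idc ?vcia //; bd.
- move=> [[x y] e] /=; apply: acel_eq => //=; exact: abar_mor_eq.
- move=> [[x' y'] e'] [[x y] e] /= f f'; exact: abar_acomp.
- move=> [[b b'] e'] [[a a'] e] /= f f'; apply: acel_eq.
  + exact: abar_acomp.
  + exact: abar_acomp.
  + exact: hcomp_eq.
  + exact: hcomp_eq.
- move=> [[a a'] e] [[b b'] e'] /= f f'; apply: acel_eq.
  + exact: abar_mor_eq.
  + exact: abar_mor_eq.
  + exact: vcomp_eq.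
  + exact: vcomp_eq.
Defined.
End Arrow.

Section ArrowMap.
Variables (A C : twocat) (F : twofun A C).

Lemma fcc (g f : A mor) : cod f = dom g -> F _ (cc g f) = cc (F _ g) (F _ f).
Proof.
move=> e; have e' : cod (F _ f) = dom (F _ g) by rewrite fcod fdom e.
by rewrite -(ccE e) -(ccE e') (fcomp F e e').
Qed.
Lemma fhc (b a : A cell) : cod (csrc a) = dom (csrc b) ->
  F _ (hc b a) = hc (F _ b) (F _ a).
Proof.
move=> e; have e' : cod (csrc (F _ a)) = dom (csrc (F _ b))
  by rewrite !fcsrc fcod fdom e.
by rewrite -(hcE e) -(hcE e') (fhcomp F e e').
Qed.
Lemma fvc (a b : A cell) : ctgt a = csrc b -> F _ (vc a b) = vc (F _ a) (F _ b).
Proof.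
move=> e; have e' : ctgt (F _ a) = csrc (F _ b) by rewrite fctgt fcsrc e.
by rewrite -(vcE e) -(vcE e') (fvcomp F e e').
Qed.

Program Definition arrmap_mor (x : amor A) : amor C :=
  @AMor C (F _ (adom x)) (F _ (acod x)) (F _ (aleft x)) (F _ (aright x))
    (F _ (acell x)) _ _ _ _ _ _.
Next Obligation. by move=> x; rewrite !fdom dom_aleft. Qed.
Next Obligation. by move=> x; rewrite fcod fdom cod_aleft. Qed.
Next Obligation. by move=> x; rewrite fcod fdom dom_aright. Qed.
Next Obligation. by move=> x; rewrite !fcod cod_aright. Qed.
Next Obligation.
by move=> x; rewrite fcsrc csrc_acell; apply: fcomp.
Qed.
Next Obligation.
by move=> x; rewrite fctgt ctgt_acell; apply: fcomp.
Qed.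

Program Definition arrmap_cel (a : acel A) : acel C :=
  @ACel C (arrmap_mor (asrc a)) (arrmap_mor (atgt a))
    (F _ (asig a)) (F _ (atau a)) _ _ _ _ _ _ _.
Next Obligation. by move=> a /=; rewrite adom_atgt. Qed.
Next Obligation. by move=> a /=; rewrite acod_atgt. Qed.
Next Obligation. by move=> a /=; rewrite fcsrc csrc_asig. Qed.
Next Obligation. by move=> a /=; rewrite fctgt ctgt_asig. Qed.
Next Obligation. by move=> a /=; rewrite fcsrc csrc_atau. Qed.
Next Obligation. by move=> a /=; rewrite fctgt ctgt_atau. Qed.
Next Obligation.
move=> a /= e1 e2 e3 e4; tot; rewrite -!fidc -!fhc; [|bd|bd].
rewrite -!fvc; [|bd|bd]. by rewrite acel_lawT.
Qed.

Lemma arrmap_acomp y x e e' :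
  arrmap_mor (@acomp _ y x e) = @acomp _ (arrmap_mor y) (arrmap_mor x) e'.
Proof.
apply: amor_eq => //=; try exact: fcomp.
tot; clear e'; rewrite -!fidc -!fhc; [|bd|bd]. by rewrite -fvc //; bd.
Qed.

Definition arrmap : twofun (arr A) (arr C).
Proof.
refine (@TwoFun (arr A) (arr C)
  (fun k => match k return arrcar A k -> arrcar C k with
  | ob => fmap F (k := mor) | mor => arrmap_mor | cell => arrmap_cel end)
  _ _ _ _ _ _ _ _ _) => //.
- by move=> u; apply: amor_eq => //=; rewrite ?fdom ?fcod ?fidm ?fidc.
- by move=> x; apply: acel_eq => //=; rewrite fidc.
- move=> y x e e'; exact: arrmap_acomp.
- move=> b a e e'; apply: acel_eq => /=.
  + exact: arrmap_acomp.
  + exact: arrmap_acomp.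
  + exact: fhcomp.
  + exact: fhcomp.
- by move=> a b e e'; apply: acel_eq => //=; apply: fvcomp.
Defined.
End ArrowMap.

Definition app2 (A B D J : twocat) (F : twofun A D) (G : twofun B D)
    (T : twofun (pb F G) J) k (x : A k) (y : B k) (e : F k x = G k y) : J k :=
  T k (pbpair e).
Arguments app2 {A B D J F G} T {k} x y e.

(* Equations between 2-functors out of iterated pullbacks are stated at each
   of the three levels, on matching tuples. *)
Record split2fib (A B : twocat) := Split2Fib {
  apex :> twocat;
  fp : twofun apex A;
  fq : twofun apex B;
  flam : twofun (pb (arr_tgt A) fp) apex;
  frho : twofun (pb fq (arr_src B)) apex;
  fp_lam : forall k x i e, fp k (app2 flam x i e) = arr_src A k x;
  fq_lam : forall k x i e, fq k (app2 flam x i e) = fq k i;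
  fp_rho : forall k i y e, fp k (app2 frho i y e) = fp k i;
  fq_rho : forall k i y e, fq k (app2 frho i y e) = arr_tgt B k y;
  lam_comp : forall k (x y : arr A k) (i : apex k) e1 e2 e3 e4,
    app2 flam (app2 (arr_comp A) x y e1) i e2 =
    app2 flam x (app2 flam y i e3) e4;
  lam_unit : forall k (i : apex k) e,
    app2 flam (arr_unit A k (fp k i)) i e = i;
  rho_comp : forall k (i : apex k) (x y : arr B k) e1 e2 e3 e4,
    app2 frho i (app2 (arr_comp B) x y e1) e2 =
    app2 frho (app2 frho i x e3) y e4;
  rho_unit : forall k (i : apex k) e,
    app2 frho i (arr_unit B k (fq k i)) e = i;
  rho_lam : forall k (x : arr A k) (i : apex k) (y : arr B k) e1 e2 e3 e4,
    app2 frho (app2 flam x i e1) y e2 = app2 flam x (app2 frho i y e3) e4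
}.

Definition locally_discrete (A B : twocat) (J : split2fib A B) :=
  forall a : J cell, is_idc (fp J cell a) -> is_idc (fq J cell a) -> is_idc a.

Section Cleavages.

(* (u, id_u, id) : (a,u,b) -> (b,id,b). *)
Program Definition amor_out (A : twocat) (u : A mor) : amor A :=
  @AMor A u (idm (cod u)) u (idm (cod u)) (idc u) _ _ _ _ _ _.
Solve Obligations with intros; simpl; bd.

(* (id, id_v, v) : (a,id,a) -> (a,v,b). *)
Program Definition amor_in (A : twocat) (v : A mor) : amor A :=
  @AMor A (idm (dom v)) v (idm (dom v)) v (idc v) _ _ _ _ _ _.
Solve Obligations with intros; simpl; bd.

(* A cell a : t => s as the morphism (s,a,t) between identities; this is both
   (v,alpha,ps) for alpha : ps => v and (qs,beta,u) for beta : u => qs. *)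
Program Definition amor_cell (A : twocat) (a : A cell) : amor A :=
  @AMor A (idm (dom (csrc a))) (idm (cod (csrc a))) (ctgt a) (csrc a) a
    _ _ _ _ _ _.
Solve Obligations with intros; simpl; bd.

Variables (A B : twocat) (J : split2fib A B).

(* u^* i, lambda_p(u,i) and alpha_! s *)
Definition lpull (u : A mor) (i : J ob) (e : cod u = fp J ob i) : J ob :=
  @app2 _ _ _ _ _ _ (flam J) ob u i e.

Lemma lpull_arr_fit (u : A mor) (i : J ob) : cod u = fp J ob i ->
  arr_tgt A mor (amor_out u) = fp J mor (idm i).
Proof. by move=> e; rewrite fidm -e. Qed.

Definition lpull_arr (u : A mor) (i : J ob) (e : cod u = fp J ob i) : J mor :=
  @app2 _ _ _ _ _ _ (flam J) mor (amor_out u) (idm i) (lpull_arr_fit e).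

Definition lpush (a : A cell) (s : J mor) (e : csrc a = fp J mor s) : J mor :=
  @app2 _ _ _ _ _ _ (flam J) mor (amor_cell a) s e.

(* v_! i, rho_q(i,v) and beta^* s *)
Definition rpush (i : J ob) (v : B mor) (e : fq J ob i = dom v) : J ob :=
  @app2 _ _ _ _ _ _ (frho J) ob i v e.

Lemma rpush_arr_fit (i : J ob) (v : B mor) : fq J ob i = dom v ->
  fq J mor (idm i) = arr_src B mor (amor_in v).
Proof. by move=> e; rewrite fidm e. Qed.

Definition rpush_arr (i : J ob) (v : B mor) (e : fq J ob i = dom v) : J mor :=
  @app2 _ _ _ _ _ _ (frho J) mor (idm i) (amor_in v) (rpush_arr_fit e).

Definition rpull (s : J mor) (b : B cell) (e : fq J mor s = ctgt b) : J mor :=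
  @app2 _ _ _ _ _ _ (frho J) mor s (amor_cell b) e.
End Cleavages.

(* A path of length n.+1, hence nonempty, with edge m from vtx m to vtx m.+1
   for m <= n; the values of vtx beyond n.+1 play no role. *)
Record fibpath (n : nat) := FibPath {
  vtx : nat -> twocat;
  edge : forall m : 'I_n.+1, split2fib (vtx m) (vtx m.+1)
}.

Section Paths.
Variables (n : nat) (P : fibpath n).

(* m : 'I_n indexes the vertex vtx m.+1 between the edges lo m and hi m. *)
Definition lo (m : 'I_n) : 'I_n.+1 := widen_ord (leqnSn n) m.
Definition hi (m : 'I_n) : 'I_n.+1 := @Ordinal n.+1 m.+1 (ltn_ord m).

Definition q_lo (m : 'I_n) : twofun (edge P (lo m)) (vtx P m.+1) :=
  fq (edge P (lo m)).
Definition p_hi (m : 'I_n) : twofun (edge P (hi m)) (vtx P m.+1) :=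
  fp (edge P (hi m)).
Definition p_first : twofun (edge P ord0) (vtx P 0) := fp (edge P ord0).
Definition q_last : twofun (edge P ord_max) (vtx P n.+1) := fq (edge P ord_max).

Definition ladder : twocat := bigprod (fun m : 'I_n.+1 => edge P m).

Definition glued (m : 'I_n) k (i : ladder k) : Prop :=
  q_lo m k (i (lo m)) = p_hi m k (i (hi m)).

(* A family glued everywhere but at m is a pair of an element of the product
   of the edges up to lo m and an element of the product of the edges from
   hi m on. *)
Definition glued_off (m : 'I_n) k (i : ladder k) : Prop :=
  forall m' : 'I_n, m' != m -> glued m' i.

Definition fibprod : twocat :=
  sub2cat (closed_all (fun m : 'I_n =>
    closed_eq (q_lo m \of bigprod_proj (fun m : 'I_n.+1 => edge P m) (lo m))
              (p_hi m \of bigprod_proj (fun m : 'I_n.+1 => edge P m) (hi m)))).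

Definition tup k (i : ladder k) (h : forall m, glued m i) : fibprod k :=
  exist _ i h.

Definition fibproj (m : 'I_n.+1) : twofun fibprod (edge P m) :=
  bigprod_proj (fun m : 'I_n.+1 => edge P m) m \of sub_incl _.

(* The tuple i with the entry at m replaced by x. *)
Definition upd k (i : ladder k) (m : 'I_n.+1) (x : edge P m k) : ladder k :=
  @dfwith 'I_n.+1 (fun m => edge P m k) i m x.

Definition ids (i : ladder ob) : ladder mor := fun m => idm (i m).

Variables (C : twocat) (f : twofun (vtx P 0) C) (g : twofun (vtx P n.+1) C).

Definition lsource : twofun fibprod C := f \of (p_first \of fibproj ord0).
Definition ltarget : twofun fibprod C := g \of (q_last \of fibproj ord_max).

Record nullary_cell := NullaryCell {
  nfun : twofun fibprod (arr C);
  nullary_src : forall k z, arr_src C k (nfun k z) = lsource k z;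
  nullary_tgt : forall k z, arr_tgt C k (nfun k z) = ltarget k z;
  nullary_left : forall k (x : arr (vtx P 0) k) (z : fibprod k)
      (e : arr_tgt (vtx P 0) k x = p_first k (sval z ord0)),
    exists h e',
    nfun k (@tup k (upd (sval z)
                     (app2 (flam (edge P ord0)) x (sval z ord0) e)) h) =
    app2 (arr_comp C) (arrmap f k x) (nfun k z) e';
  nullary_right : forall k (z : fibprod k) (y : arr (vtx P n.+1) k)
      (e : q_last k (sval z ord_max) = arr_src (vtx P n.+1) k y),
    exists h e',
    nfun k (@tup k (upd (sval z)
                     (app2 (frho (edge P ord_max)) (sval z ord_max) y e)) h) =
    app2 (arr_comp C) (nfun k z) (arrmap g k y) e';
  nullary_mid : forall (m : 'I_n) k (i : ladder k) (x : arr (vtx P m.+1) k)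
      (e : q_lo m k (i (lo m)) = arr_src (vtx P m.+1) k x)
      (e' : arr_tgt (vtx P m.+1) k x = p_hi m k (i (hi m))),
    glued_off m i ->
    exists h h',
    nfun k (@tup k (upd i (app2 (frho (edge P (lo m))) (i (lo m)) x e)) h) =
    nfun k (@tup k (upd i (app2 (flam (edge P (hi m))) x (i (hi m)) e')) h')
}.

Section Conditions.
Variable phi : laxnat lsource ltarget.

Definition poc : Prop :=
  forall (s : fibprod mor) (a : vtx P 0 cell)
    (e : csrc a = p_first mor (sval s ord0)),
  exists h e1 e2,
  lcell phi (@tup mor (upd (sval s) (@lpush _ _ (edge P ord0) a _ e)) h) =
  vcomp (lcell phi s) (lwh (lcomp phi (cod s)) (f cell a) e1) e2.

Definition iec : Prop :=
  forall (m : 'I_n) (s : ladder mor) (a : vtx P m.+1 cell)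
    (e : csrc a = p_hi m mor (s (hi m))) (e' : q_lo m mor (s (lo m)) = ctgt a),
  glued_off m s ->
  exists h h',
  lcell phi (@tup mor (upd s (@rpull _ _ (edge P (lo m)) (s (lo m)) a e')) h) =
  lcell phi (@tup mor (upd s (@lpush _ _ (edge P (hi m)) a (s (hi m)) e)) h').

Definition pcc : Prop :=
  forall (s : fibprod mor) (a : vtx P n.+1 cell)
    (e : q_last mor (sval s ord_max) = ctgt a),
  exists h e1 e2,
  lcell phi (@tup mor (upd (sval s) (@rpull _ _ (edge P ord_max) _ a e)) h) =
  vcomp (rwh (g cell a) (lcomp phi (dom s)) e1) (lcell phi s) e2.

Definition cm : Prop :=
  forall (i : fibprod ob) (u : vtx P 0 mor)
    (e : cod u = p_first ob (sval i ord0)),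
  (exists h e1,
   lcomp phi (@tup ob (upd (sval i) (@lpull _ _ (edge P ord0) u _ e)) h) =
   mcomp (lcomp phi i) (f mor u) e1) /\
  (exists h, is_idc (lcell phi
     (@tup mor (upd (ids (sval i)) (@lpull_arr _ _ (edge P ord0) u _ e)) h))).

Definition im : Prop :=
  forall (m : 'I_n) (i : ladder ob) (u : vtx P m.+1 mor)
    (e : q_lo m ob (i (lo m)) = dom u) (e' : cod u = p_hi m ob (i (hi m))),
  glued_off m i ->
  (exists h h',
   lcomp phi (@tup ob (upd i (@lpull _ _ (edge P (hi m)) u _ e')) h) =
   lcomp phi (@tup ob (upd i (@rpush _ _ (edge P (lo m)) _ u e)) h')) /\
  (exists h, is_idc (lcell phi
     (@tup mor (upd (upd (ids i) (@rpush_arr _ _ (edge P (lo m)) _ u e))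
                    (@lpull_arr _ _ (edge P (hi m)) u _ e')) h))).

Definition om : Prop :=
  forall (i : fibprod ob) (u : vtx P n.+1 mor)
    (e : q_last ob (sval i ord_max) = dom u),
  (exists h e1,
   lcomp phi (@tup ob (upd (sval i) (@rpush _ _ (edge P ord_max) _ u e)) h) =
   mcomp (g mor u) (lcomp phi i) e1) /\
  (exists h, is_idc (lcell phi
     (@tup mor (upd (ids (sval i)) (@rpush_arr _ _ (edge P ord_max) _ u e)) h))).
End Conditions.
End Paths.

(* The lax natural transformation corresponding to a 2-functor into the lax
   arrow 2-category. *)
Section LaxOfFun.
Variables (X C : twocat) (F G : twofun X C) (T : twofun X (arr C)).
Hypotheses (hs : forall k x, arr_src C k (T k x) = F k x)
           (ht : forall k x, arr_tgt C k (T k x) = G k x).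

Program Definition lax_of_fun : laxnat F G :=
  @LaxNat X C F G (fmap T (k := ob)) (fun s => acell (T mor s)) _ _ _ _ _ _ _.
Next Obligation. exact: (hs (k := ob)). Qed.
Next Obligation. exact: (ht (k := ob)). Qed.
Next Obligation.
move=> s e; rewrite csrc_acell; apply: comp_eq; first exact: (ht s).
exact: (fdom T s).
Qed.
Next Obligation.
move=> s e; rewrite ctgt_acell; apply: comp_eq; last exact: (hs s).
exact: (fcod T s).
Qed.
Next Obligation.
move=> a e1 e2 e3 e4; tot.
have := acel_lawT (T cell a).
rewrite -(hs a) -(ht a) /=.
by rewrite -!(fdom T) -!(fcod T) -!(fcsrc T) -(fctgt T) /= => ->.
Qed.
Next Obligation. by move=> x /=; rewrite (fidm T). Qed.
Next Obligation.
move=> t s e e1 e2 e3 /=.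
have e' : cod (T mor s) = dom (T mor t) by rewrite fcod fdom e.
rewrite (fcomp T e e') acompE; tot.
by rewrite -(hs s) -(ht t).
Qed.
End LaxOfFun.

Definition lax_of_nullary n (P : fibpath n) (C : twocat)
    (f : twofun (vtx P 0) C) (g : twofun (vtx P n.+1) C)
    (N : nullary_cell f g) : laxnat (lsource f) (ltarget g) :=
  lax_of_fun (nullary_src N) (nullary_tgt N).

(* All cells between paths of locally discrete fibrations are kept. *)
Record ldfibpath (n : nat) := LdFibPath {
  ldpath :> fibpath n;
  ldpathP : forall m, locally_discrete (edge ldpath m)
}.

Definition ldnullary_cell n (P : ldfibpath n) (C : twocat)
    (f : twofun (vtx P 0) C) (g : twofun (vtx P n.+1) C) : Type :=
  nullary_cell f g.

Definition lax_of_ldnullary n (P : ldfibpath n) (C : twocat)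
    (f : twofun (vtx P 0) C) (g : twofun (vtx P n.+1) C) :
    ldnullary_cell f g -> laxnat (lsource f) (ltarget g) :=
  @lax_of_nullary n P C f g.

(* F restricts to a bijection from X onto the elements of Y satisfying S. *)
Definition bij_onto (X Y : Type) (F : X -> Y) (S : Y -> Prop) : Prop :=
  (forall x, S (F x)) /\ (forall y, S y -> exists! x, F x = y).

(* Main.v *)
Require Import Defs.
From mathcomp Require Import all_boot.
From Stdlib Require Import ProofIrrelevance FunctionalExtensionality.

(** A 2-functor into the lax arrow 2-category of C amounts to its two
    projections to C together with a lax natural transformation between them
    ([fun_of_lax], [lax_of_fun_inj]).  Under this correspondence the three
    equations defining a nullary cell become equations between components on
    objects and equations between naturality cells on morphisms.  On cells
    they follow from the other two levels, because a cell of the lax arrow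
    2-category is determined by its boundary and its two projections.

    Conditions (poc), (iec) and (pcc) are naturality of phi at a cell.  The
    canonical cells from s to alpha_! s and from beta^* s to s ([lpush_cell],
    [rpull_cell]) lie over alpha or beta on one side and over an identity on
    the other.  Completed by identity cells in the remaining entries, one of
    them (at an end of the path), or two adjacent ones lying over the same
    alpha (in the middle), form a cell of the iterated pullback at which one or
    both of the outer 2-functors give an identity; naturality there is the
    asserted equation ([lax_poc], [lax_pcc], [lax_iec]).

    A nullary cell satisfies (cm) and (om) by its equations evaluated at
    objects and at the morphisms of arrows underlying the cleavages.  For (im),
    the middle equation moves the action of (id,id,u) from the left entry onto
    lambda_p(u,i) in the right one, and there the composite of (id,id,u) and
    (u,id,id) is the identity of the object u ([lam_in_out], [nullary_im]).

    The converse has to recover the action of an arbitrary morphism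
    x = (s,zeta,t) from u0 to u1 out of these two special cases.  Its key is
    the factorisation
      lambda_p(u1,j) o lambda(x,i') = zeta_!(i' o lambda_p(u0,i)),
    for i' from i to j, and its mirror image for rho ([lam_square],
    [rho_square]).  By (cm) the naturality cell of phi at a cleavage arrow is an
    identity, so composing with such an arrow only whiskers the naturality cell
    ([lcell_comp_idr], [lcell_comp_idl]), and (poc) evaluates the right-hand
    side: the result is the composite in C^2 demanded of a nullary cell
    ([cm_lcell], and [om_lcell] at the other end).  In the middle the same
    factorisations turn both sides of the required equation into the two sides
    of (iec) ([im_mid_mor]). *)

Set Implicit Arguments.
Unset Strict Implicit.
Unset Printing Implicit Defensive.
#[local] Obligation Tactic := idtac.
Import Total.

(** * Lax natural transformations and the lax arrow 2-category *)

Section Lax.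
Variables (X C : twocat) (F G : twofun X C).

Lemma laxnat_eq (phi psi : laxnat F G) :
  lcomp phi =1 lcomp psi -> lcell phi =1 lcell psi -> phi = psi.
Proof.
case: phi => u c p1 p2 p3 p4 p5 p6 p7; case: psi => v d q1 q2 q3 q4 q5 q6 q7.
move=> /= /functional_extensionality ? /functional_extensionality ?; subst.
by f_equal; apply: proof_irrelevance.
Qed.

Lemma twofun_eq (S T : twofun X C) : (forall k x, S k x = T k x) -> S = T.
Proof.
case: S => S p1 p2 p3 p4 p5 p6 p7 p8 p9; case: T => T q1 q2 q3 q4 q5 q6 q7 q8 q9.
move=> /= e; have {e}? : S = T.
  by do 2 (apply: functional_extensionality_dep => ?); apply: e.
by subst; f_equal; apply: proof_irrelevance.
Qed.

Variable phi : laxnat F G.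
Implicit Types (s t : X mor) (a : X cell).

(** The lemmas with suffix T restate the axioms of a lax natural
    transformation with the total compositions [cc], [hc] and [vc], for which
    composability proofs need not be carried through rewriting. *)
Lemma csrc_lcellT s : csrc (lcell phi s) = cc (G mor s) (lcomp phi (dom s)).
Proof.
have e : cod (lcomp phi (dom s)) = dom (G mor s) by rewrite cod_lcomp fdom.
by rewrite (csrc_lcell e) ccE.
Qed.

Lemma ctgt_lcellT s : ctgt (lcell phi s) = cc (lcomp phi (cod s)) (F mor s).
Proof.
have e : cod (F mor s) = dom (lcomp phi (cod s)) by rewrite dom_lcomp fcod.
by rewrite (ctgt_lcell e) ccE.
Qed.

Lemma cod_lcomp_fit s : cod (lcomp phi (dom s)) = dom (G mor s).
Proof. by rewrite cod_lcomp fdom. Qed.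

Lemma dom_lcomp_fit s : cod (F mor s) = dom (lcomp phi (cod s)).
Proof. by rewrite dom_lcomp fcod. Qed.

Lemma dom_csrc_lcell s : dom (csrc (lcell phi s)) = F ob (dom s).
Proof. by rewrite csrc_lcellT dom_cc ?dom_lcomp // cod_lcomp_fit. Qed.

Lemma cod_csrc_lcell s : cod (csrc (lcell phi s)) = G ob (cod s).
Proof. by rewrite csrc_lcellT cod_cc ?fcod // cod_lcomp_fit. Qed.

Lemma lcell_natT a :
  vc (hc (G cell a) (idc (lcomp phi (dom (csrc a))))) (lcell phi (ctgt a)) =
  vc (lcell phi (csrc a)) (hc (idc (lcomp phi (cod (csrc a)))) (F cell a)).
Proof.
have e1 : cod (lcomp phi (dom (csrc a))) = dom (csrc (G cell a)).
  by rewrite fcsrc cod_lcomp_fit.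
have e3 : cod (csrc (F cell a)) = dom (lcomp phi (cod (csrc a))).
  by rewrite fcsrc dom_lcomp_fit.
have e2 : ctgt (rwh (G cell a) (lcomp phi (dom (csrc a))) e1) =
    csrc (lcell phi (ctgt a)).
  by rewrite rwhE ctgt_hc ?csrc_idc // ctgt_idc fctgt csrc_lcellT dom_ctgt.
have e4 : ctgt (lcell phi (csrc a)) =
    csrc (lwh (lcomp phi (cod (csrc a))) (F cell a) e3).
  by rewrite lwhE csrc_hc ?csrc_idc // fcsrc ctgt_lcellT.
by have := lcell_nat e2 e4; rewrite !vcE lwhE rwhE.
Qed.

Lemma lcell_compT t s (e : cod s = dom t) :
  lcell phi (mcomp t s e) =
  vc (hc (idc (G mor t)) (lcell phi s)) (hc (lcell phi t) (idc (F mor s))).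
Proof.
have e1 : cod (csrc (lcell phi s)) = dom (G mor t).
  by rewrite cod_csrc_lcell fdom e.
have e2 : cod (F mor s) = dom (csrc (lcell phi t)).
  by rewrite dom_csrc_lcell fcod e.
have e3 : ctgt (lwh (G mor t) (lcell phi s) e1) =
    csrc (rwh (lcell phi t) (F mor s) e2).
  rewrite lwhE rwhE ctgt_hc ?csrc_idc // csrc_hc ?csrc_idc //.
  rewrite ctgt_lcellT csrc_lcellT ctgt_idc -e ccA ?dom_lcomp_fit //.
  by rewrite cod_lcomp fdom e.
by rewrite (lcell_comp e e3) vcE lwhE rwhE.
Qed.

Program Definition fun_of_lax_mor s : amor C :=
  @AMor C (lcomp phi (dom s)) (lcomp phi (cod s)) (F mor s) (G mor s)
    (lcell phi s) _ _ _ _ _ _.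
Next Obligation. by move=> s; rewrite fdom dom_lcomp. Qed.
Next Obligation. by move=> s; rewrite dom_lcomp_fit. Qed.
Next Obligation. by move=> s; rewrite cod_lcomp_fit. Qed.
Next Obligation. by move=> s; rewrite fcod cod_lcomp. Qed.
Next Obligation. by move=> s; rewrite csrc_lcellT ccE. Qed.
Next Obligation. by move=> s; rewrite ctgt_lcellT ccE. Qed.

Program Definition fun_of_lax_cel a : acel C :=
  @ACel C (fun_of_lax_mor (csrc a)) (fun_of_lax_mor (ctgt a)) (F cell a) (G cell a)
    _ _ _ _ _ _ _.
Next Obligation. by move=> a /=; rewrite dom_ctgt. Qed.
Next Obligation. by move=> a /=; rewrite cod_ctgt. Qed.
Next Obligation. by move=> a; rewrite fcsrc. Qed.
Next Obligation. by move=> a; rewrite fctgt. Qed.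
Next Obligation. by move=> a; rewrite fcsrc. Qed.
Next Obligation. by move=> a; rewrite fctgt. Qed.
Next Obligation. by move=> a e1 e2 e3 e4 /=; tot; rewrite lcell_natT. Qed.

Lemma fun_of_lax_comp t s e e' :
  fun_of_lax_mor (@mcomp X t s e) = @acomp C (fun_of_lax_mor t) (fun_of_lax_mor s) e'.
Proof.
apply: amor_eq => //=; rewrite ?dom_comp ?cod_comp //; try exact: fcomp.
by rewrite vcE lwhE rwhE lcell_compT.
Qed.

Definition fun_of_lax : twofun X (arr C).
Proof.
refine (@TwoFun X (arr C)
  (fun k => match k return X k -> arrcar C k with
  | ob => lcomp phi | mor => fun_of_lax_mor | cell => fun_of_lax_cel end)
  _ _ _ _ _ _ _ _ _) => //.
- by move=> x; apply: amor_eq => //=;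
    rewrite ?dom_idm ?cod_idm ?dom_lcomp ?cod_lcomp ?fidm ?lcell_idm.
- by move=> s; apply: acel_eq => //=; rewrite ?csrc_idc ?ctgt_idc ?fidc.
- exact: fun_of_lax_comp.
- move=> b a e e'.
  have es : cod (csrc a) = dom (csrc b) by [].
  have et : cod (ctgt a) = dom (ctgt b) by rewrite cod_ctgt dom_ctgt.
  apply: acel_eq => /=; try exact: fhcomp.
  + by rewrite (csrc_hcomp e es); apply: fun_of_lax_comp.
  + by rewrite (ctgt_hcomp e et); apply: fun_of_lax_comp.
- move=> a b e e'; apply: acel_eq => /=; try exact: fvcomp.
  + by rewrite csrc_vcomp.
  + by rewrite ctgt_vcomp.
Defined.

Lemma fun_of_lax_src k x : arr_src C k (fun_of_lax k x) = F k x.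
Proof. by case: k x => //= x; apply: dom_lcomp. Qed.

Lemma fun_of_lax_tgt k x : arr_tgt C k (fun_of_lax k x) = G k x.
Proof. by case: k x => //= x; apply: cod_lcomp. Qed.

End Lax.

(** The projections of T are given, so the transformation leaves no freedom:
    the boundary of T at a morphism comes from its values on objects, and T at
    a cell is determined by its boundary and projections. *)
Lemma lax_of_fun_inj (X C : twocat) (F G : twofun X C) (T T' : twofun X (arr C))
    (hs : forall k x, arr_src C k (T k x) = F k x)
    (ht : forall k x, arr_tgt C k (T k x) = G k x)
    (hs' : forall k x, arr_src C k (T' k x) = F k x)
    (ht' : forall k x, arr_tgt C k (T' k x) = G k x) :
  lax_of_fun hs ht = lax_of_fun hs' ht' -> T = T'.
Proof.
move=> e.
have eo x : T ob x = T' ob x by have := congr1 (fun p => lcomp p x) e.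
have em s : T mor s = T' mor s.
  apply: amor_eq.
  - by have /= -> := fdom T s; rewrite eo -(fdom T').
  - by have /= -> := fcod T s; rewrite eo -(fcod T').
  - by have /= -> := hs mor s; have /= -> := hs' mor s.
  - by have /= -> := ht mor s; have /= -> := ht' mor s.
  - by have := congr1 (fun p => lcell p s) e.
apply: twofun_eq => -[] // a; apply: acel_eq.
- by have /= -> := fcsrc T a; rewrite em -(fcsrc T').
- by have /= -> := fctgt T a; rewrite em -(fctgt T').
- by have /= -> := hs cell a; have /= -> := hs' cell a.
- by have /= -> := ht cell a; have /= -> := ht' cell a.
Qed.

Lemma nullary_eq n (P : fibpath n) (C : twocat)
    (f : twofun (vtx P 0) C) (g : twofun (vtx P n.+1) C)
    (N N' : nullary_cell f g) : nfun N = nfun N' -> N = N'.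
Proof.
case: N => T p1 p2 p3 p4 p5; case: N' => T' q1 q2 q3 q4 q5 /= ?; subst.
by f_equal; apply: proof_irrelevance.
Qed.

Section LaxComp.
Variables (X C : twocat) (F G : twofun X C) (phi : laxnat F G).
Implicit Types (s t : X mor) (a : X cell).

Lemma lcell_comp_fit t s : cod s = dom t ->
  ctgt (hc (idc (G mor t)) (lcell phi s)) =
  csrc (hc (lcell phi t) (idc (F mor s))).
Proof.
move=> e.
rewrite ctgt_hc ?csrc_idc ?cod_csrc_lcell ?fdom ?e //.
rewrite csrc_hc ?csrc_idc ?dom_csrc_lcell ?fcod ?e //.
rewrite ctgt_lcellT csrc_lcellT ctgt_idc -e ccA ?(dom_lcomp_fit phi) //.
by rewrite cod_lcomp fdom e.
Qed.

(** Where phi is strictly natural, pasting reduces to whiskering.  This is how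
    triviality on the cleavages is used. *)
Lemma lcell_comp_idr t s e : is_idc (lcell phi s) ->
  lcell phi (@mcomp X t s e) = hc (lcell phi t) (idc (F mor s)).
Proof.
move=> [h eh]; have := lcell_comp_fit e; rewrite lcell_compT eh.
rewrite hc_idc; last by rewrite -(csrc_idc h) -eh cod_csrc_lcell fdom e.
by rewrite ctgt_idc => fit; rewrite vcia.
Qed.

Lemma lcell_comp_idl t s e : is_idc (lcell phi t) ->
  lcell phi (@mcomp X t s e) = hc (idc (G mor t)) (lcell phi s).
Proof.
move=> [h eh]; have := lcell_comp_fit e; rewrite lcell_compT eh.
rewrite hc_idc; last by rewrite -(csrc_idc h) -eh dom_csrc_lcell fcod e.
by rewrite csrc_idc => fit; rewrite vcai.
Qed.

(** Naturality at a cell collapsed by one of the two 2-functors; this is the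
    common source of the three conditions on cells. *)
Lemma lcell_ctgt a : is_idc (G cell a) ->
  lcell phi (ctgt a) =
  vc (lcell phi (csrc a)) (hc (idc (lcomp phi (cod (csrc a)))) (F cell a)).
Proof.
move=> [h eh]; have eh' : h = G mor (csrc a) by rewrite -(csrc_idc h) -eh fcsrc.
have eh'' : h = G mor (ctgt a) by rewrite -(ctgt_idc h) -eh fctgt.
rewrite -lcell_natT eh hc_idc ?vcia ?eh' ?(cod_lcomp_fit phi) //.
by rewrite csrc_lcellT -eh' eh'' dom_ctgt.
Qed.

Lemma lcell_csrc a : is_idc (F cell a) ->
  lcell phi (csrc a) =
  vc (hc (G cell a) (idc (lcomp phi (dom (csrc a))))) (lcell phi (ctgt a)).
Proof.
move=> [h eh]; have eh' : h = F mor (csrc a) by rewrite -(csrc_idc h) -eh fcsrc.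
rewrite lcell_natT eh hc_idc ?vcai ?eh' ?(dom_lcomp_fit phi) //.
by rewrite ctgt_lcellT.
Qed.
End LaxComp.

(** * Actions of arrows and cleavages *)

Section App2.
Variables (A B D J : twocat) (F : twofun A D) (G : twofun B D).
Variable T : twofun (pb F G) J.

(** [app2 T] is a 2-functor of two variables on matching pairs; the lemmas
    below are its preservation of each operation. *)
Lemma app2_eq k (x x' : A k) (y y' : B k) e e' :
  x = x' -> y = y' -> app2 T x y e = app2 T x' y' e'.
Proof. by move=> ? ?; subst; rewrite (proof_irrelevance _ e e'). Qed.

Lemma app2_dom x y e e' : dom (@app2 _ _ _ _ _ _ T mor x y e) =
  app2 T (dom x) (dom y) e'.
Proof. by rewrite /app2 fdom; congr (T _ _); apply: subcar_inj. Qed.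
Lemma app2_cod x y e e' : cod (@app2 _ _ _ _ _ _ T mor x y e) =
  app2 T (cod x) (cod y) e'.
Proof. by rewrite /app2 fcod; congr (T _ _); apply: subcar_inj. Qed.
Lemma app2_csrc x y e e' : csrc (@app2 _ _ _ _ _ _ T cell x y e) =
  app2 T (csrc x) (csrc y) e'.
Proof. by rewrite /app2 fcsrc; congr (T _ _); apply: subcar_inj. Qed.
Lemma app2_ctgt x y e e' : ctgt (@app2 _ _ _ _ _ _ T cell x y e) =
  app2 T (ctgt x) (ctgt y) e'.
Proof. by rewrite /app2 fctgt; congr (T _ _); apply: subcar_inj. Qed.
Lemma app2_idm x y e e' :
  app2 T (idm x) (idm y) e = idm (@app2 _ _ _ _ _ _ T ob x y e').
Proof. by rewrite /app2 -fidm; congr (T _ _); apply: subcar_inj. Qed.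

Lemma app2_mcomp (x' x : A mor) (y' y : B mor) e' e h hx hy hxy :
  mcomp (app2 T x' y' e') (app2 T x y e) h =
  app2 T (mcomp x' x hx) (mcomp y' y hy) hxy.
Proof.
have hp : cod (pbpair e) = dom (pbpair e') by apply: subcar_inj; apply: Defs.pair_eq.
rewrite /app2 -(fcomp T hp h); congr (T _ _).
by apply: subcar_inj; apply: Defs.pair_eq; apply: comp_eq.
Qed.

Lemma pb_mcomp_fit (x' x : A mor) (y' y : B mor) hx hy :
  F mor x' = G mor y' -> F mor x = G mor y ->
  F mor (mcomp x' x hx) = G mor (mcomp y' y hy).
Proof. by move=> e e'; rewrite !ccE !fcc // e e'. Qed.
End App2.

Section ArrowCells.
Variable A : twocat.

(** The cells (alpha, id) and (id, beta) of the lax arrow 2-category, whose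
    actions are the canonical cells s => alpha_! s and beta^* s => s. *)
Program Definition acel_push (a : A cell) : acel A :=
  @ACel A (amor_of (csrc a)) (amor_cell a) a (idc (csrc a)) _ _ _ _ _ _ _.
Solve Obligations with try solve [intros; simpl; bd].
Next Obligation.
by move=> a /= *; tot; rewrite hcia ?hcai //; bd.
Qed.

Program Definition acel_pull (a : A cell) : acel A :=
  @ACel A (amor_cell a) (amor_of (ctgt a)) (idc (ctgt a)) a _ _ _ _ _ _ _.
Solve Obligations with try solve [intros; simpl; bd].
Next Obligation.
by move=> a /= *; tot; rewrite hcia ?hcai //; bd.
Qed.

(** For x = (s,zeta,t), composing with (u1,id,id) leaves a square from u0 to an
    identity filled by zeta.  The same square is built from zeta, read as a
    square between identities, and the square (t o u0, id, t), which is the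
    composite of two squares filled by identities. *)
Lemma amor_out_comp (x : amor A) t h h' h'' : t = aright x ->
  @acomp A (amor_out (acod x)) x h =
  @abar_mor A (amor_cell (acell x))
    (@acomp A (amor_of t) (amor_out (adom x)) h') h''.
Proof.
move=> ?; subst; apply: amor_eq => //=; tot; clear h h' h''; try by bd.
by rewrite ?hc_idc ?hcia ?hcai ?vcai ?vcia; bd.
Qed.

Lemma comp_amor_in (x : amor A) s h h' h'' : s = aleft x ->
  @acomp A x (amor_in (adom x)) h =
  @abar_mor A (@acomp A (amor_in (acod x)) (amor_of s) h')
    (amor_cell (acell x)) h''.
Proof.
move=> ?; subst; apply: amor_eq => //=; tot; clear h h' h''; try by bd.
by rewrite ?hc_idc ?hcia ?hcai ?vcai ?vcia; bd.
Qed.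

Lemma abar_in_out (u : A mor) h : @abar_mor A (amor_in u) (amor_out u) h = aidm u.
Proof.
apply: amor_eq => //=; tot; clear h; try by bd.
by rewrite !hc_idc ?vcia; bd.
Qed.
End ArrowCells.

Section Actions.
Variables (A B : twocat) (J : split2fib A B).

(** The factorisation lambda_p(u1,j) o lambda(x,s) = zeta_!(s o lambda_p(u0,i)).
    By 2-functoriality the left side is the action of a composite in A^2 on s;
    writing s as the action of a unit on itself, the right side is also an
    action on s, by associativity of lambda, and [amor_out_comp] identifies the
    two acting morphisms. *)
Lemma lam_square (x : arr A mor) (s : J mor) e
    (e1 : cod (acod x) = fp J ob (cod s)) (e0 : cod (adom x) = fp J ob (dom s))
    h h' e2 :
  mcomp (lpull_arr e1) (app2 (flam J) x s e) h =
  lpush (a := acell x) (s := mcomp s (lpull_arr e0) h') e2.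
Proof.
have k1 : cod x = dom (amor_out (acod x) : arr A mor) by [].
have k2 : cod s = dom (idm (cod s)) by rewrite dom_idm.
have k3 : arr_tgt A mor (arr_unit A mor (fp J mor s)) = fp J mor s by [].
have k4 : cod (amor_out (adom x) : arr A mor) =
    dom (arr_unit A mor (fp J mor s)) by rewrite /= -e /= dom_aright.
have k5 : cod (idm (dom s)) = dom s by rewrite cod_idm.
have k6 := pb_mcomp_fit k4 k5 k3 (lpull_arr_fit e0).
have e3 : mcomp s (lpull_arr e0) h' = app2 (flam J) _ _ k6.
  have k7 : cod (lpull_arr e0) = dom (app2 (flam J) _ s k3) by rewrite lam_unit.
  rewrite -(app2_mcomp k7); apply: comp_eq => //.
  by rewrite lam_unit.
have k8 : arr_tgt A mor (amor_cell (acell x)) = fp J mor (app2 (flam J) _ _ k6).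
  by rewrite -e3.
have k9 : arr_tgt A mor (amor_cell (acell x)) = arr_src A mor
    (mcomp (arr_unit A mor (fp J mor s)) (amor_out (adom x) : arr A mor) k4).
  by rewrite k8 fp_lam.
have k10 : arr_tgt A mor (app2 (arr_comp A) _ _ k9) =
    fp J mor (mcomp s (idm (dom s)) k5) by rewrite -k6.
rewrite /lpull_arr (app2_mcomp h (pb_mcomp_fit k1 k2 (lpull_arr_fit e1) e)).
transitivity (app2 (flam J) _ _ k10).
  apply: app2_eq; last by rewrite compif compfi.
  exact: amor_out_comp.
by rewrite (lam_comp k10 k8) /lpush; apply: app2_eq.
Qed.

(** The mirror image: rho(s,y) o rho_q(i,v0) = zeta^*(rho_q(j,v1) o s). *)
Lemma rho_square (s : J mor) (y : arr B mor) e
    (e0 : fq J ob (dom s) = dom (adom y)) (e1 : fq J ob (cod s) = dom (acod y))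
    h h' e2 :
  mcomp (app2 (frho J) s y e) (rpush_arr e0) h =
  rpull (s := mcomp (rpush_arr e1) s h') (b := acell y) e2.
Proof.
have k1 : cod (amor_in (adom y) : arr B mor) = dom y by [].
have k2 : cod (idm (dom s)) = dom s by rewrite cod_idm.
have k3 : fq J mor s = arr_src B mor (arr_unit B mor (fq J mor s)) by [].
have k4 : cod (arr_unit B mor (fq J mor s)) =
    dom (amor_in (acod y) : arr B mor) by rewrite /= e /= cod_aleft.
have k5 : cod s = dom (idm (cod s)) by rewrite dom_idm.
have k6 := pb_mcomp_fit k5 k4 (rpush_arr_fit e1) k3.
have e3 : mcomp (rpush_arr e1) s h' = app2 (frho J) _ _ k6.
  have k7 : cod (app2 (frho J) s _ k3) = dom (rpush_arr e1) by rewrite rho_unit.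
  rewrite -(app2_mcomp k7); apply: comp_eq => //.
  by rewrite rho_unit.
have k8 : fq J mor (app2 (frho J) _ _ k6) = arr_src B mor (amor_cell (acell y)).
  by rewrite -e3.
have k9 : arr_tgt B mor
    (mcomp (amor_in (acod y) : arr B mor) (arr_unit B mor (fq J mor s)) k4) =
    arr_src B mor (amor_cell (acell y)).
  by rewrite -k8 fq_rho.
have k10 : fq J mor (mcomp (idm (cod s)) s k5) =
    arr_src B mor (app2 (arr_comp B) _ _ k9) by rewrite k6.
rewrite /rpush_arr (app2_mcomp h (pb_mcomp_fit k2 k1 e (rpush_arr_fit e0))).
transitivity (app2 (frho J) _ _ k10).
  apply: app2_eq; first by rewrite compif compfi.
  exact: comp_amor_in.
by rewrite (rho_comp k10 k8) /rpull; apply: app2_eq.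
Qed.

(** The squares (id,id_u,u) and (u,id_u,id) compose to the identity of the
    object u of A^2, so acting with the first undoes the second. *)
Lemma lam_in_out (u : A mor) (i : J ob) (e : cod u = fp J ob i) e' :
  app2 (flam J) (amor_in u : arr A mor) (lpull_arr e) e' = idm (lpull e).
Proof.
have k1 : arr_tgt A mor (amor_in u) = arr_src A mor (amor_out u) by [].
have k2 : arr_tgt A mor (app2 (arr_comp A) _ _ k1) = fp J mor (idm i).
  by rewrite fidm -e.
rewrite -(lam_comp k2).
have k3 : arr_tgt A mor (idm (u : arr A ob)) = fp J mor (idm i).
  by rewrite !fidm /= e.
rewrite -(app2_idm _ k3); apply: app2_eq => //; exact: abar_in_out.
Qed.

Lemma dom_lpull_arr (u : A mor) (i : J ob) (e : cod u = fp J ob i) :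
  dom (lpull_arr e) = lpull e.
Proof.
have k : arr_tgt A ob (dom (amor_out u : arr A mor)) = fp J ob (dom (idm i)).
  by rewrite dom_idm.
by rewrite (app2_dom _ _ k); apply: app2_eq => //; rewrite dom_idm.
Qed.

Lemma cod_lpull_arr (u : A mor) (i : J ob) (e : cod u = fp J ob i) :
  cod (lpull_arr e) = i.
Proof.
have k : arr_tgt A ob (cod (amor_out u : arr A mor)) = fp J ob (cod (idm i)).
  by rewrite cod_idm /= cod_idm.
have k' : arr_tgt A ob (arr_unit A ob (fp J ob i)) = fp J ob i.
  by rewrite /= cod_idm.
rewrite (app2_cod _ _ k) -[RHS](lam_unit k'); apply: app2_eq => /=.
  by rewrite e.
by rewrite cod_idm.
Qed.

Lemma dom_rpush_arr (v : B mor) (i : J ob) (e : fq J ob i = dom v) :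
  dom (rpush_arr e) = i.
Proof.
have k : fq J ob (dom (idm i)) = arr_src B ob (dom (amor_in v : arr B mor)).
  by rewrite dom_idm /= dom_idm.
have k' : fq J ob i = arr_src B ob (arr_unit B ob (fq J ob i)).
  by rewrite /= dom_idm.
rewrite (app2_dom _ _ k) -[RHS](rho_unit k'); apply: app2_eq => /=.
  by rewrite dom_idm.
by rewrite e.
Qed.

Lemma cod_rpush_arr (v : B mor) (i : J ob) (e : fq J ob i = dom v) :
  cod (rpush_arr e) = rpush e.
Proof.
have k : fq J ob (cod (idm i)) = arr_src B ob (cod (amor_in v : arr B mor)).
  by rewrite cod_idm.
by rewrite (app2_cod _ _ k); apply: app2_eq => //; rewrite cod_idm.
Qed.

Section PushCell.
Variables (a : A cell) (s : J mor) (e : csrc a = fp J mor s).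

Lemma lpush_cell_fit : arr_tgt A cell (acel_push a) = fp J cell (idc s).
Proof. by rewrite fidc -e. Qed.

Definition lpush_cell : J cell := app2 (flam J) _ _ lpush_cell_fit.

Lemma csrc_lpush_cell : csrc lpush_cell = s.
Proof.
have k : arr_tgt A mor (csrc (acel_push a : arr A cell)) = fp J mor (csrc (idc s)).
  by rewrite csrc_idc.
have k' : arr_tgt A mor (arr_unit A mor (fp J mor s)) = fp J mor s by [].
rewrite (app2_csrc _ _ k) -[RHS](lam_unit k'); apply: app2_eq => /=.
  by rewrite e.
by rewrite csrc_idc.
Qed.

Lemma ctgt_lpush_cell : ctgt lpush_cell = lpush e.
Proof.
have k : arr_tgt A mor (ctgt (acel_push a : arr A cell)) = fp J mor (ctgt (idc s)).
  by rewrite ctgt_idc.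
by rewrite (app2_ctgt _ _ k); apply: app2_eq => //; rewrite ctgt_idc.
Qed.

Lemma fp_lpush_cell : fp J cell lpush_cell = a.
Proof. by rewrite fp_lam. Qed.

Lemma fq_lpush_cell : fq J cell lpush_cell = idc (fq J mor s).
Proof. by rewrite fq_lam fidc. Qed.
End PushCell.

Section PullCell.
Variables (b : B cell) (s : J mor) (e : fq J mor s = ctgt b).

Lemma rpull_cell_fit : fq J cell (idc s) = arr_src B cell (acel_pull b).
Proof. by rewrite fidc e. Qed.

Definition rpull_cell : J cell := app2 (frho J) _ _ rpull_cell_fit.

Lemma csrc_rpull_cell : csrc rpull_cell = rpull e.
Proof.
have k : fq J mor (csrc (idc s)) = arr_src B mor (csrc (acel_pull b : arr B cell)).
  by rewrite csrc_idc.
by rewrite (app2_csrc _ _ k); apply: app2_eq => //; rewrite csrc_idc.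
Qed.

Lemma ctgt_rpull_cell : ctgt rpull_cell = s.
Proof.
have k : fq J mor (ctgt (idc s)) = arr_src B mor (ctgt (acel_pull b : arr B cell)).
  by rewrite ctgt_idc.
have k' : fq J mor s = arr_src B mor (arr_unit B mor (fq J mor s)) by [].
rewrite (app2_ctgt _ _ k) -[RHS](rho_unit k'); apply: app2_eq => /=.
  by rewrite ctgt_idc.
by rewrite e.
Qed.

Lemma fp_rpull_cell : fp J cell rpull_cell = idc (fp J mor s).
Proof. by rewrite fp_rho fidc. Qed.

Lemma fq_rpull_cell : fq J cell rpull_cell = b.
Proof. by rewrite fq_rho. Qed.
End PullCell.
End Actions.

(** * Tuples in the pullback of a path *)

Section Tuples.
Variables (n : nat) (P : fibpath n).
Implicit Types (m : 'I_n.+1) (l : 'I_n).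

Lemma fib_eq k (x y : fibprod P k) : (forall m, sval x m = sval y m) -> x = y.
Proof. by move=> e; apply: subcar_inj; apply: functional_extensionality_dep. Qed.

(** The entries of composites in the pullback, as rewriting rules.  Those for
    explicit tuples, [tupE], are to be exhausted before the general ones,
    [fibE]: entries of a tuple may carry proofs about entries of another element
    of the pullback, in which [fibE] would meet an ill-typed rewrite. *)
Lemma fib_tup k (i : ladder P k) h m : sval (tup (i := i) h) m = i m.
Proof. by []. Qed.
Lemma fib_dom (s : fibprod P mor) m : sval (dom s) m = dom (sval s m).
Proof. by []. Qed.
Lemma fib_cod (s : fibprod P mor) m : sval (cod s) m = cod (sval s m).
Proof. by []. Qed.
Lemma fib_csrc (a : fibprod P cell) m : sval (csrc a) m = csrc (sval a m).
Proof. by []. Qed.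
Lemma fib_ctgt (a : fibprod P cell) m : sval (ctgt a) m = ctgt (sval a m).
Proof. by []. Qed.
Lemma fib_idm (i : fibprod P ob) m : sval (idm i) m = idm (sval i m).
Proof. by []. Qed.
Lemma fib_mcomp (t s : fibprod P mor) e m :
  sval (mcomp t s e) m = cc (sval t m) (sval s m).
Proof. exact: ccE. Qed.

Lemma tup_dom (i : ladder P mor) h m : sval (dom (tup (i := i) h)) m = dom (i m).
Proof. by []. Qed.
Lemma tup_cod (i : ladder P mor) h m : sval (cod (tup (i := i) h)) m = cod (i m).
Proof. by []. Qed.
Lemma tup_csrc (i : ladder P cell) h m :
  sval (csrc (tup (i := i) h)) m = csrc (i m).
Proof. by []. Qed.
Lemma tup_ctgt (i : ladder P cell) h m :
  sval (ctgt (tup (i := i) h)) m = ctgt (i m).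
Proof. by []. Qed.
Lemma tup_idm (i : ladder P ob) h m :
  sval (idm (tup (i := i) h)) m = idm (i m).
Proof. by []. Qed.
Lemma tup_mcomp (i j : ladder P mor) h h' e m :
  sval (mcomp (tup (i := i) h) (tup (i := j) h') e) m = cc (i m) (j m).
Proof. exact: ccE. Qed.

Definition tupE :=
  (fib_tup, tup_dom, tup_cod, tup_csrc, tup_ctgt, tup_idm, tup_mcomp).
Definition fibE := (fib_dom, fib_cod, fib_csrc, fib_ctgt, fib_idm, fib_mcomp).

Lemma upd_in k (i : ladder P k) m (x : edge P m k) : upd i x m = x.
Proof. exact: dfwith_in. Qed.

Lemma upd_out k (i : ladder P k) m (x : edge P m k) m' :
  m != m' -> upd i x m' = i m'.
Proof. by move=> ?; apply: dfwith_out. Qed.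

Lemma fq_upd k (i : ladder P k) m (x : edge P m k) :
  fq (edge P m) k x = fq (edge P m) k (i m) ->
  forall m', fq (edge P m') k (upd i x m') = fq (edge P m') k (i m').
Proof.
by move=> e m'; case: (eqVneq m m') => [<-|ne]; rewrite ?upd_in // upd_out.
Qed.

Lemma fp_upd k (i : ladder P k) m (x : edge P m k) :
  fp (edge P m) k x = fp (edge P m) k (i m) ->
  forall m', fp (edge P m') k (upd i x m') = fp (edge P m') k (i m').
Proof.
by move=> e m'; case: (eqVneq m m') => [<-|ne]; rewrite ?upd_in // upd_out.
Qed.

Lemma lo_neq_hi l : lo l != hi l.
Proof. by rewrite -val_eqE /= neq_ltn ltnSn. Qed.

Lemma hi_neq0 l : ord0 != hi l.
Proof. by []. Qed.

Lemma lo_neq_max l : ord_max != lo l.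
Proof. by rewrite -val_eqE /= neq_ltn ltn_ord orbT. Qed.

Lemma lo_inj l l' : l' != l -> lo l != lo l'.
Proof. by rewrite eq_sym -!val_eqE. Qed.

Lemma hi_inj l l' : l' != l -> hi l != hi l'.
Proof. by rewrite eq_sym -!val_eqE. Qed.

(** Gluing only sees the q-image of the left entry and the p-image of the right
    one, so an action at one end of the path, or on the far side of an edge,
    preserves it. *)
Lemma glued_ext k (i j : ladder P k) l : glued l i ->
  fq (edge P (lo l)) k (j (lo l)) = fq (edge P (lo l)) k (i (lo l)) ->
  fp (edge P (hi l)) k (j (hi l)) = fp (edge P (hi l)) k (i (hi l)) ->
  glued l j.
Proof. by move=> e e1 e2; apply: (etrans e1); apply: (etrans e); rewrite -e2. Qed.

Lemma glued_first k (i : ladder P k) (x : edge P ord0 k) :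
  (forall l, glued l i) -> fq (edge P ord0) k x = fq (edge P ord0) k (i ord0) ->
  forall l, glued l (upd i x).
Proof.
move=> h e l; apply: (glued_ext (h l)); first exact: fq_upd.
by rewrite upd_out // hi_neq0.
Qed.

Lemma glued_last k (i : ladder P k) (x : edge P ord_max k) :
  (forall l, glued l i) ->
  fp (edge P ord_max) k x = fp (edge P ord_max) k (i ord_max) ->
  forall l, glued l (upd i x).
Proof.
move=> h e l; apply: (glued_ext (h l)); last exact: fp_upd.
by rewrite upd_out // lo_neq_max.
Qed.

Lemma glued_lo k (i : ladder P k) l (x : edge P (lo l) k) :
  glued_off l i -> q_lo P l k x = p_hi P l k (i (hi l)) ->
  fp (edge P (lo l)) k x = fp (edge P (lo l)) k (i (lo l)) ->
  forall l', glued l' (upd i x).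
Proof.
move=> h e e' l'; case: (eqVneq l' l) => [->|ne].
  by rewrite /glued upd_in upd_out // lo_neq_hi.
apply: (glued_ext (h _ ne)); last exact: fp_upd.
by rewrite upd_out // lo_inj.
Qed.

Lemma glued_hi k (i : ladder P k) l (x : edge P (hi l) k) :
  glued_off l i -> q_lo P l k (i (lo l)) = p_hi P l k x ->
  fq (edge P (hi l)) k x = fq (edge P (hi l)) k (i (hi l)) ->
  forall l', glued l' (upd i x).
Proof.
move=> h e e' l'; case: (eqVneq l' l) => [->|ne].
  by rewrite /glued upd_in upd_out // eq_sym lo_neq_hi.
apply: (glued_ext (h _ ne)); first exact: fq_upd.
by rewrite upd_out // hi_inj.
Qed.

Lemma glued_off_lo k (i : ladder P k) l (x : edge P (lo l) k) :
  glued_off l i ->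
  fp (edge P (lo l)) k x = fp (edge P (lo l)) k (i (lo l)) ->
  glued_off l (upd i x).
Proof.
move=> h e' l' ne; apply: (glued_ext (h _ ne)); last exact: fp_upd.
by rewrite upd_out // lo_inj.
Qed.

Lemma glued_off_hi k (i : ladder P k) l (x : edge P (hi l) k) :
  glued_off l i ->
  fq (edge P (hi l)) k x = fq (edge P (hi l)) k (i (hi l)) ->
  glued_off l (upd i x).
Proof.
move=> h e' l' ne; apply: (glued_ext (h _ ne)); first exact: fq_upd.
by rewrite upd_out // hi_inj.
Qed.

Lemma glued_both k (i : ladder P k) l (x : edge P (lo l) k) (y : edge P (hi l) k) :
  glued_off l i -> q_lo P l k x = p_hi P l k y ->
  fp (edge P (lo l)) k x = fp (edge P (lo l)) k (i (lo l)) ->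
  fq (edge P (hi l)) k y = fq (edge P (hi l)) k (i (hi l)) ->
  forall l', glued l' (upd (upd i x) y).
Proof.
move=> h e e1 e2; apply: glued_hi; first exact: glued_off_lo.
  by rewrite upd_in.
by rewrite upd_out // lo_neq_hi.
Qed.

Definition idcs (s : ladder P mor) : ladder P cell := fun m => idc (s m).

Lemma glued_ids l (i : ladder P ob) : glued l i -> glued l (ids i).
Proof. by rewrite /glued /ids !fidm => ->. Qed.

Lemma glued_idcs l (s : ladder P mor) : glued l s -> glued l (idcs s).
Proof. by rewrite /glued /idcs !fidc => ->. Qed.

Lemma glued_off_ids l (i : ladder P ob) : glued_off l i -> glued_off l (ids i).
Proof. by move=> h l' ne; apply/glued_ids/h. Qed.

Lemma glued_off_idcs l (s : ladder P mor) : glued_off l s -> glued_off l (idcs s).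
Proof. by move=> h l' ne; apply/glued_idcs/h. Qed.

End Tuples.

(** * The conditions on cells hold for every lax natural transformation *)

Section LaxCells.
Variables (X C : twocat) (F G : twofun X C) (phi : laxnat F G).

(** The three shapes of naturality at a cell a from s to t, according to which
    of the 2-functors F and G sends a to an identity. *)
Lemma lcell_push a (s t : X mor) (b : C cell) :
  csrc a = s -> ctgt a = t -> is_idc (G cell a) -> F cell a = b ->
  exists e1 e2, lcell phi t = vcomp (lcell phi s) (lwh (lcomp phi (cod s)) b e1) e2.
Proof.
move=> <- <- hG <-.
have e1 : cod (csrc (F cell a)) = dom (lcomp phi (cod (csrc a))).
  by rewrite fcsrc; apply: dom_lcomp_fit.
exists e1.
have e2 : ctgt (lcell phi (csrc a)) =
    csrc (lwh (lcomp phi (cod (csrc a))) (F cell a) e1).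
  by rewrite lwhE csrc_hc ?csrc_idc // fcsrc ctgt_lcellT.
by exists e2; rewrite lcell_ctgt // vcE lwhE.
Qed.

Lemma lcell_pull a (s t : X mor) (b : C cell) :
  csrc a = t -> ctgt a = s -> is_idc (F cell a) -> G cell a = b ->
  exists e1 e2, lcell phi t = vcomp (rwh b (lcomp phi (dom s)) e1) (lcell phi s) e2.
Proof.
move=> <- <- hF <-; rewrite dom_ctgt.
have e1 : cod (lcomp phi (dom (csrc a))) = dom (csrc (G cell a)).
  by rewrite fcsrc; apply: cod_lcomp_fit.
exists e1.
have e2 : ctgt (rwh (G cell a) (lcomp phi (dom (csrc a))) e1) =
    csrc (lcell phi (ctgt a)).
  by rewrite rwhE ctgt_hc ?csrc_idc // ctgt_idc fctgt csrc_lcellT dom_ctgt.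
by exists e2; rewrite lcell_csrc // vcE rwhE.
Qed.

Lemma lcell_glide a (s t : X mor) :
  csrc a = s -> ctgt a = t -> is_idc (F cell a) -> is_idc (G cell a) ->
  lcell phi s = lcell phi t.
Proof.
move=> <- <- [h eh] hG; rewrite [RHS]lcell_ctgt // eh.
have eh' : h = F mor (csrc a) by rewrite -(csrc_idc h) -eh fcsrc.
by rewrite hc_idc ?vcai ?eh' ?(dom_lcomp_fit phi) // ctgt_lcellT.
Qed.
End LaxCells.

Section CellConditions.
Variables (n : nat) (P : fibpath n) (C : twocat).
Variables (f : twofun (vtx P 0) C) (g : twofun (vtx P n.+1) C).
Variable phi : laxnat (lsource f) (ltarget g).

(** Naturality at (lambda_p(s_1,alpha), id, ..., id), which lies over alpha at
    the first vertex and over an identity at the last. *)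
Lemma lax_poc : poc phi.
Proof.
move=> s a e.
have hq : fq (edge P ord0) cell (lpush_cell e) =
    fq (edge P ord0) cell (idcs (sval s) ord0) by rewrite fq_lpush_cell -fidc.
have hc l : glued l (upd (idcs (sval s)) (lpush_cell e)).
  by apply: glued_first => // l'; apply: glued_idcs; apply: (svalP s).
have ht l : glued l (upd (sval s) (lpush e)).
  by apply: glued_first; [exact: (svalP s) | rewrite fq_lam].
exists ht; apply: (@lcell_push _ _ _ _ phi (tup hc)).
- apply: fib_eq => m; rewrite ?tupE ?fibE; case: (eqVneq ord0 m) => [<-|ne].
    by rewrite upd_in csrc_lpush_cell.
  by rewrite upd_out // csrc_idc.
- apply: fib_eq => m; rewrite ?tupE ?fibE; case: (eqVneq ord0 m) => [<-|ne].
    by rewrite !upd_in ctgt_lpush_cell.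
  by rewrite !upd_out // ctgt_idc.
- rewrite /= /q_last (fq_upd hq) !fidc; by eexists.
- by rewrite /= upd_in /p_first fp_lpush_cell.
Qed.

Lemma lax_pcc : pcc phi.
Proof.
move=> s a e.
have hp : fp (edge P ord_max) cell (rpull_cell e) =
    fp (edge P ord_max) cell (idcs (sval s) ord_max)
  by rewrite fp_rpull_cell -fidc.
have hc l : glued l (upd (idcs (sval s)) (rpull_cell e)).
  by apply: glued_last => // l'; apply: glued_idcs; apply: (svalP s).
have ht l : glued l (upd (sval s) (rpull e)).
  by apply: glued_last; [exact: (svalP s) | rewrite fp_rho].
exists ht; apply: (@lcell_pull _ _ _ _ phi (tup hc)).
- apply: fib_eq => m; rewrite ?tupE ?fibE; case: (eqVneq ord_max m) => [<-|ne].
    by rewrite !upd_in csrc_rpull_cell.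
  by rewrite !upd_out // csrc_idc.
- apply: fib_eq => m; rewrite ?tupE ?fibE; case: (eqVneq ord_max m) => [<-|ne].
    by rewrite !upd_in ctgt_rpull_cell.
  by rewrite !upd_out // ctgt_idc.
- rewrite /= /p_first (fp_upd hp) !fidc; by eexists.
- by rewrite /= upd_in /q_last fq_rpull_cell.
Qed.

(** Naturality at (id, ..., rho_q(alpha,s_m), lambda_p(s_(m+1),alpha), ..., id).
    Its two entries both lie over alpha in the middle, so they match, and it
    lies over identities at both ends. *)
Lemma lax_iec : iec phi.
Proof.
move=> l s a e e' hs.
have hp : fp (edge P (lo l)) cell (rpull_cell e') =
    fp (edge P (lo l)) cell (idcs s (lo l)) by rewrite fp_rpull_cell -fidc.
have hq : fq (edge P (hi l)) cell (lpush_cell e) =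
    fq (edge P (hi l)) cell (idcs s (hi l)) by rewrite fq_lpush_cell -fidc.
have hc l' : glued l' (upd (upd (idcs s) (rpull_cell e')) (lpush_cell e)).
  apply: glued_both => //; first exact: glued_off_idcs.
  by rewrite /q_lo fq_rpull_cell /p_hi fp_lpush_cell.
have h l' : glued l' (upd s (rpull e')).
  apply: glued_lo => //; last by rewrite fp_rho.
  by rewrite /q_lo fq_rho -e.
have h' l' : glued l' (upd s (lpush e)).
  apply: glued_hi => //; last by rewrite fq_lam.
  by rewrite /p_hi fp_lam e'.
exists h, h'; apply: (@lcell_glide _ _ _ _ phi (tup hc)).
- apply: fib_eq => m; rewrite ?tupE ?fibE; case: (eqVneq (hi l) m) => [<-|ne].
    by rewrite upd_in csrc_lpush_cell upd_out // lo_neq_hi.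
  rewrite upd_out //; case: (eqVneq (lo l) m) => [<-|ne'].
    by rewrite !upd_in csrc_rpull_cell.
  by rewrite !upd_out // csrc_idc.
- apply: fib_eq => m; rewrite ?tupE ?fibE; case: (eqVneq (hi l) m) => [<-|ne].
    by rewrite !upd_in ctgt_lpush_cell.
  rewrite upd_out // [RHS]upd_out //; case: (eqVneq (lo l) m) => [<-|ne'].
    by rewrite !upd_in ctgt_rpull_cell.
  by rewrite !upd_out // ctgt_idc.
- rewrite /= /p_first upd_out; last by rewrite eq_sym hi_neq0.
  rewrite (fp_upd hp) !fidc; by eexists.
- rewrite /= /q_last fq_upd; last first.
    by rewrite upd_out // lo_neq_hi.
  rewrite upd_out ?fidc; last by rewrite eq_sym lo_neq_max.
  by eexists.
Qed.
End CellConditions.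

(** * Nullary cells satisfy the conditions on components *)

(** Composing in the other direction of the double category of squares also
    preserves squares filled by identities. *)
Lemma abar_idc (A : twocat) (x y : amor A) (e : aright x = aleft y) :
  is_idc (acell x) -> is_idc (acell y) -> is_idc (acell (abar_mor e)).
Proof.
move=> [h eh] [h' eh']; have hd := abar_dom e; have hc' := abar_cod e.
have ex : h = cc (aright x) (adom x) by rewrite -csrc_acellT eh csrc_idc.
have ey : h' = cc (acod y) (aleft y) by rewrite -ctgt_acellT eh' ctgt_idc.
exists (cc h' (adom x)); rewrite abarE eh eh' hc_idc; last by rewrite ey; bd.
rewrite hc_idc; last by rewrite ex; bd.
rewrite vcai // ctgt_idc ex ey -ccA; [|bd|bd].
by rewrite e.
Qed.

Lemma is_idc_lcell_idm (X D : twocat) (F G : twofun X D) (psi : laxnat F G) x :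
  is_idc (lcell psi (idm x)).
Proof. by exists (lcomp psi x); apply: lcell_idm. Qed.

Lemma is_idc_fmap_idc (X D : twocat) (F : twofun X D) s : is_idc (F cell (idc s)).
Proof. by exists (F mor s); apply: fidc. Qed.

Section NullaryConditions.
Variables (n : nat) (P : fibpath n) (C : twocat).
Variables (f : twofun (vtx P 0) C) (g : twofun (vtx P n.+1) C).
Variable N : nullary_cell f g.
Notation phi := (lax_of_nullary N).

Lemma nullary_cm : cm phi.
Proof.
move=> i u e; split.
  have [h [e' E]] := nullary_left N (k := ob) (z := i) (x := u) e.
  by exists h, e'; apply: (etrans E); apply: comp_eq.
have [h [e' E]] := nullary_left N (k := mor) (z := idm i) (x := amor_out u)
  (lpull_arr_fit e).
exists h; rewrite /= E; apply: abar_idc; first exact: is_idc_fmap_idc.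
exact: (is_idc_lcell_idm phi).
Qed.

Lemma nullary_om : om phi.
Proof.
move=> i u e; split.
  have [h [e' E]] := nullary_right N (k := ob) (z := i) (y := u) e.
  by exists h, e'; apply: (etrans E); apply: comp_eq.
have [h [e' E]] := nullary_right N (k := mor) (z := idm i) (y := amor_in u)
  (rpush_arr_fit e).
exists h; rewrite /= E; apply: abar_idc; last exact: is_idc_fmap_idc.
exact: (is_idc_lcell_idm phi).
Qed.

(** The middle equation at u gives the components.  For the naturality cell it
    is used at the tuple s with entries id and lambda_p(u,i_(m+1)): acting with
    (id,id,u) on its left entry produces the cleavage tuple, acting on its right
    entry an identity tuple, by [lam_in_out]. *)
Lemma nullary_im : im phi.
Proof.
move=> l i u e e' hi'; split.
  have [h [h' E]] := nullary_mid N (k := ob) (x := u) e e' hi'.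
  by exists h', h.
have hp : fp (edge P (lo l)) mor (rpush_arr e) =
    fp (edge P (lo l)) mor (ids i (lo l)) by rewrite fp_rho.
have hq : fq (edge P (hi l)) mor (lpull_arr e') =
    fq (edge P (hi l)) mor (ids i (hi l)) by rewrite fq_lam.
have h l' : glued l' (upd (upd (ids i) (rpush_arr e)) (lpull_arr e')).
  apply: glued_both => //; first exact: glued_off_ids.
  by rewrite /q_lo fq_rho /p_hi fp_lam.
have h0 l' : glued l' (upd i (lpull e')).
  by apply: glued_hi => //; rewrite ?fq_lam // /p_hi fp_lam.
exists h; pose s := upd (ids i) (lpull_arr e').
have k1 : s (lo l) = idm (i (lo l)) by rewrite /s upd_out // eq_sym lo_neq_hi.
have k2 : s (hi l) = lpull_arr e' by rewrite /s upd_in.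
have k3 : q_lo P l mor (s (lo l)) = arr_src (vtx P l.+1) mor (amor_in u).
  by rewrite k1 /q_lo (rpush_arr_fit e).
have k4 : arr_tgt (vtx P l.+1) mor (amor_in u) = p_hi P l mor (s (hi l)).
  by rewrite k2 /p_hi fp_lam.
have k5 : glued_off l s by apply: glued_off_hi => //; apply: glued_off_ids.
have [h1 [h2 E]] := nullary_mid N k3 k4 k5.
have -> : tup h = tup h1.
  apply: fib_eq => m; rewrite ?tupE ?fibE; case: (eqVneq (lo l) m) => [<-|ne].
    rewrite upd_out 1?eq_sym ?lo_neq_hi // !upd_in; exact: app2_eq.
  rewrite [RHS]upd_out //; case: (eqVneq (hi l) m) => [<-|ne'].
    by rewrite upd_in k2.
  by rewrite /s !upd_out.
rewrite /= E; have -> : tup h2 = idm (tup h0).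
  apply: fib_eq => m; rewrite ?tupE ?fibE; case: (eqVneq (hi l) m) => [<-|ne].
    rewrite !upd_in; have k6 : arr_tgt _ mor (amor_in u) =
      fp (edge P (hi l)) mor (lpull_arr e') by rewrite fp_lam.
    by rewrite -(lam_in_out k6); apply: app2_eq.
  by rewrite /s !upd_out.
exact: (is_idc_lcell_idm phi).
Qed.
End NullaryConditions.

(** * From the conditions on components to a nullary cell *)

Section Absorb.
Variables (X C : twocat) (F G : twofun X C) (phi : laxnat F G).

(** A morphism on which phi is strict and whose image under G (or F) is an
    identity can be cancelled: this is what becomes of the cleavage tuples. *)
Lemma lcell_absorbl t s e y : is_idc (lcell phi t) -> G mor t = idm y ->
  lcell phi (@mcomp X t s e) = lcell phi s.
Proof.
move=> ht eG; rewrite lcell_comp_idl // eG hcia //.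
by rewrite cod_csrc_lcell e -fdom eG dom_idm.
Qed.

Lemma lcell_absorbr t s e x : is_idc (lcell phi s) -> F mor s = idm x ->
  lcell phi (@mcomp X t s e) = lcell phi t.
Proof.
move=> hs eF; rewrite lcell_comp_idr // eF hcai //.
by rewrite dom_csrc_lcell -e -fcod eF cod_idm.
Qed.
End Absorb.

Lemma arrmap_src (A C : twocat) (F : twofun A C) k x :
  arr_src C k (arrmap F k x) = F k (arr_src A k x).
Proof. by case: k x => //= x; apply: fdom. Qed.

Lemma arrmap_tgt (A C : twocat) (F : twofun A C) k x :
  arr_tgt C k (arrmap F k x) = F k (arr_tgt A k x).
Proof. by case: k x => //= x; apply: fcod. Qed.

Section Fits.
Variables (A B : twocat) (J : split2fib A B).

Lemma lam_cod_fit (x : arr A mor) (s : J mor) :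
  arr_tgt A mor x = fp J mor s -> cod (acod x) = fp J ob (cod s).
Proof. by move=> e; rewrite -fcod -e /= cod_aright. Qed.

Lemma lam_dom_fit (x : arr A mor) (s : J mor) :
  arr_tgt A mor x = fp J mor s -> cod (adom x) = fp J ob (dom s).
Proof. by move=> e; rewrite -fdom -e /= dom_aright. Qed.

Lemma rho_cod_fit (s : J mor) (y : arr B mor) :
  fq J mor s = arr_src B mor y -> fq J ob (cod s) = dom (acod y).
Proof. by move=> e; rewrite -fcod e /= cod_aleft. Qed.

Lemma rho_dom_fit (s : J mor) (y : arr B mor) :
  fq J mor s = arr_src B mor y -> fq J ob (dom s) = dom (adom y).
Proof. by move=> e; rewrite -fdom e /= dom_aleft. Qed.

Lemma cod_lam (x : arr A mor) (s : J mor) e (e1 : cod (acod x) = fp J ob (cod s)) :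
  cod (app2 (flam J) x s e) = lpull e1.
Proof. exact: app2_cod. Qed.

Lemma dom_lam (x : arr A mor) (s : J mor) e (e0 : cod (adom x) = fp J ob (dom s)) :
  dom (app2 (flam J) x s e) = lpull e0.
Proof. exact: app2_dom. Qed.

Lemma cod_rho (s : J mor) (y : arr B mor) e (e1 : fq J ob (cod s) = dom (acod y)) :
  cod (app2 (frho J) s y e) = rpush e1.
Proof. exact: app2_cod. Qed.

Lemma dom_rho (s : J mor) (y : arr B mor) e (e0 : fq J ob (dom s) = dom (adom y)) :
  dom (app2 (frho J) s y e) = rpush e0.
Proof. exact: app2_dom. Qed.

Lemma fp_comp_lpull (u : A mor) (s : J mor) (e0 : cod u = fp J ob (dom s)) h :
  fp J mor (mcomp s (lpull_arr e0) h) = cc (fp J mor s) u.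
Proof. by rewrite ccE fcc // fp_lam. Qed.

Lemma fq_comp_lpull (u : A mor) (s : J mor) (e0 : cod u = fp J ob (dom s)) h :
  fq J mor (mcomp s (lpull_arr e0) h) = fq J mor s.
Proof. by rewrite ccE fcc // fq_lam fidm ccfi // fdom. Qed.

Lemma fp_rpush_comp (v : B mor) (s : J mor) (e1 : fq J ob (cod s) = dom v) h :
  fp J mor (mcomp (rpush_arr e1) s h) = fp J mor s.
Proof. by rewrite ccE fcc // fp_rho fidm ccif // fcod. Qed.

Lemma fq_rpush_comp (v : B mor) (s : J mor) (e1 : fq J ob (cod s) = dom v) h :
  fq J mor (mcomp (rpush_arr e1) s h) = cc v (fq J mor s).
Proof. by rewrite ccE fcc // fq_rho. Qed.
End Fits.

Section Construction.
Variables (n : nat) (P : fibpath n) (C : twocat).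
Variables (f : twofun (vtx P 0) C) (g : twofun (vtx P n.+1) C).
Variable phi : laxnat (lsource f) (ltarget g).
Notation T := (fun_of_lax phi).

Section Left.
Hypothesis hcm : cm phi.

(** In the notation of [lam_square], the tuple z acted on by x, followed by the
    cleavage tuple c1 over u1, is zeta_! applied to S, where S is the cleavage
    tuple c0 over u0 followed by z.  Evaluating phi on both sides, c1 disappears
    as phi and g are trivial on it, c0 contributes whiskering by f u0, and (poc)
    contributes f zeta. *)
Lemma cm_lcell (z : fibprod P mor) (x : arr (vtx P 0) mor)
    (e : arr_tgt (vtx P 0) mor x = p_first P mor (sval z ord0)) h :
  lcell phi (@tup n P mor (upd (sval z)
      (app2 (flam (edge P ord0)) x (sval z ord0) e)) h) =
  vc (hc (lcell phi z) (idc (f mor (adom x))))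
     (hc (idc (lcomp phi (cod z))) (f cell (acell x))).
Proof.
have e0 : cod (adom x) = p_first P ob (sval (dom z) ord0) := lam_dom_fit e.
have e1 : cod (acod x) = p_first P ob (sval (cod z) ord0) := lam_cod_fit e.
have [_ [h0 I0]] := hcm e0; have [_ [h1 I1]] := hcm e1.
have k0 : cod (tup h0) = dom z.
  apply: fib_eq => m; rewrite ?tupE ?fibE; case: (eqVneq ord0 m) => [<-|ne].
    by rewrite upd_in cod_lpull_arr.
  by rewrite upd_out // cod_idm.
have k1 : cod (tup h) = dom (tup h1).
  apply: fib_eq => m; rewrite ?tupE ?fibE; case: (eqVneq ord0 m) => [<-|ne].
    by rewrite !upd_in dom_lpull_arr; apply: cod_lam.
  by rewrite !upd_out // dom_idm.
pose S := mcomp z (tup h0) k0.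
have k2 : cod (lpull_arr e0) = dom (sval z ord0) by rewrite cod_lpull_arr.
have e2 : sval S ord0 = mcomp (sval z ord0) (lpull_arr e0) k2.
  by rewrite fib_mcomp fib_tup upd_in ccE.
have e3 : csrc (acell x) = p_first P mor (sval S ord0).
  by rewrite e2 /p_first fp_comp_lpull csrc_acellT -e.
have [h3 [p1 [p2]]] := @lax_poc _ _ _ _ _ phi S (acell x) e3.
have -> : tup h3 = mcomp (tup h1) (tup h) k1.
  apply: fib_eq => m; rewrite ?tupE ?fibE; case: (eqVneq ord0 m) => [<-|ne].
    have k3 : cod (app2 (flam (edge P ord0)) x (sval z ord0) e) =
        dom (lpull_arr e1) by rewrite dom_lpull_arr; apply: cod_lam.
    have e4 : csrc (acell x) =
        fp (edge P ord0) mor (mcomp (sval z ord0) (lpull_arr e0) k2).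
      by rewrite -e2.
    rewrite upd_in; transitivity (lpush e4); first exact: app2_eq.
    by rewrite -(lam_square k3) ccE !upd_in.
  by rewrite !upd_out // ccif // /S fib_mcomp fib_tup upd_out // ccfi.
have eG : ltarget g mor (tup h1) =
    idm (ltarget g ob (cod z)).
  rewrite /= /q_last fq_upd; last by rewrite fq_lam.
  by rewrite /ids !fidm.
rewrite (lcell_absorbl _ I1 eG) => ->; rewrite vcE lwhE lcell_comp_idr //.
have -> : lsource f mor (tup h0) = f mor (adom x).
  by rewrite /= upd_in /p_first fp_lam.
by rewrite cod_comp.
Qed.

Lemma cm_left_mor (z : fibprod P mor) (x : arr (vtx P 0) mor)
    (e : arr_tgt (vtx P 0) mor x = p_first P mor (sval z ord0)) h e' :
  fun_of_lax_mor phi (@tup n P mor (upd (sval z)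
      (app2 (flam (edge P ord0)) x (sval z ord0) e)) h) =
  @abar_mor C (arrmap_mor f x) (fun_of_lax_mor phi z) e'.
Proof.
have e0 : cod (adom x) = p_first P ob (sval (dom z) ord0) := lam_dom_fit e.
have e1 : cod (acod x) = p_first P ob (sval (cod z) ord0) := lam_cod_fit e.
have [[h0 [d0 E0]] _] := hcm e0; have [[h1 [d1 E1]] _] := hcm e1.
apply: amor_eq.
- apply: etrans (etrans E0 _); last exact: comp_eq.
  congr lcomp; apply: fib_eq => m; rewrite ?tupE ?fibE; case: (eqVneq ord0 m) => [<-|ne].
    by rewrite !upd_in; apply: dom_lam.
  by rewrite !upd_out.
- apply: etrans (etrans E1 _); last exact: comp_eq.
  congr lcomp; apply: fib_eq => m; rewrite ?tupE ?fibE; case: (eqVneq ord0 m) => [<-|ne].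
    by rewrite !upd_in; apply: cod_lam.
  by rewrite !upd_out.
- by rewrite /= upd_in /p_first fp_lam.
- by rewrite /= /q_last fq_upd // fq_lam.
- by rewrite abarE; apply: cm_lcell.
Qed.

(** On cells the boundary is settled by [cm_left_mor] and the projections by the
    axioms on p and q of lambda. *)
Lemma cm_left k (x : arr (vtx P 0) k) (z : fibprod P k)
    (e : arr_tgt (vtx P 0) k x = p_first P k (sval z ord0)) :
  exists h e',
  T k (@tup n P k (upd (sval z) (app2 (flam (edge P ord0)) x (sval z ord0) e)) h)
    = app2 (arr_comp C) (arrmap f k x) (T k z) e'.
Proof.
have h l : glued l (upd (sval z) (app2 (flam (edge P ord0)) x (sval z ord0) e)).
  by apply: glued_first; [exact: (svalP z) | rewrite fq_lam].
have e' : arr_tgt C k (arrmap f k x) = arr_src C k (T k z).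
  by rewrite arrmap_tgt e fun_of_lax_src.
exists h, e'; case: k x z e h e' => x z e h e'.
- have [[h0 [d0 E0]] _] := hcm e.
  by rewrite (proof_irrelevance _ h h0); apply: (etrans E0); apply: comp_eq.
- exact: cm_left_mor.
- have es : arr_tgt (vtx P 0) mor (csrc x) = p_first P mor (sval (csrc z) ord0).
    by rewrite -fcsrc e fcsrc.
  have et : arr_tgt (vtx P 0) mor (ctgt x) = p_first P mor (sval (ctgt z) ord0).
    by rewrite -fctgt e fctgt.
  have hs l : glued l
      (upd (sval (csrc z)) (app2 (flam (edge P ord0)) (csrc x) _ es)).
    by apply: glued_first; [exact: (svalP (csrc z)) | rewrite fq_lam].
  have ht l : glued l
      (upd (sval (ctgt z)) (app2 (flam (edge P ord0)) (ctgt x) _ et)).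
    by apply: glued_first; [exact: (svalP (ctgt z)) | rewrite fq_lam].
  apply: acel_eq.
  + apply: etrans (cm_left_mor hs _); congr fun_of_lax_mor; apply: fib_eq => m; rewrite ?tupE ?fibE.
    case: (eqVneq ord0 m) => [<-|ne]; last by rewrite !upd_out.
    by rewrite !upd_in; apply: app2_csrc.
  + apply: etrans (cm_left_mor ht _); congr fun_of_lax_mor; apply: fib_eq => m; rewrite ?tupE ?fibE.
    case: (eqVneq ord0 m) => [<-|ne]; last by rewrite !upd_out.
    by rewrite !upd_in; apply: app2_ctgt.
  + by rewrite /= upd_in /p_first fp_lam.
  + by rewrite /= /q_last fq_upd // fq_lam.
Qed.
End Left.

Section Right.
Hypothesis hom : om phi.

(** As [cm_lcell], with [rho_square] and (pcc): the cleavage arrow at the source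
    disappears and the one at the target contributes whiskering by g v1. *)
Lemma om_lcell (z : fibprod P mor) (y : arr (vtx P n.+1) mor)
    (e : q_last P mor (sval z ord_max) = arr_src (vtx P n.+1) mor y) h :
  lcell phi (@tup n P mor (upd (sval z)
      (app2 (frho (edge P ord_max)) (sval z ord_max) y e)) h) =
  vc (hc (g cell (acell y)) (idc (lcomp phi (dom z))))
     (hc (idc (g mor (acod y))) (lcell phi z)).
Proof.
have e0 : q_last P ob (sval (dom z) ord_max) = dom (adom y) := rho_dom_fit e.
have e1 : q_last P ob (sval (cod z) ord_max) = dom (acod y) := rho_cod_fit e.
have [_ [h0 I0]] := hom e0; have [_ [h1 I1]] := hom e1.
have k0 : cod z = dom (tup h1).
  apply: fib_eq => m; rewrite ?tupE ?fibE; case: (eqVneq ord_max m) => [<-|ne].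
    by rewrite upd_in dom_rpush_arr.
  by rewrite upd_out // dom_idm.
have k1 : cod (tup h0) = dom (tup h).
  apply: fib_eq => m; rewrite ?tupE ?fibE; case: (eqVneq ord_max m) => [<-|ne].
    by rewrite !upd_in cod_rpush_arr; symmetry; apply: dom_rho.
  by rewrite !upd_out // cod_idm.
pose S := mcomp (tup h1) z k0.
have k2 : cod (sval z ord_max) = dom (rpush_arr e1) by rewrite dom_rpush_arr.
have e2 : sval S ord_max = mcomp (rpush_arr e1) (sval z ord_max) k2.
  by rewrite fib_mcomp fib_tup upd_in ccE.
have e3 : q_last P mor (sval S ord_max) = ctgt (acell y).
  by rewrite e2 /q_last fq_rpush_comp ctgt_acellT -[aleft y]e.
have [h3 [p1 [p2]]] := @lax_pcc _ _ _ _ _ phi S (acell y) e3.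
have -> : tup h3 = mcomp (tup h) (tup h0) k1.
  apply: fib_eq => m; rewrite ?tupE ?fibE; case: (eqVneq ord_max m) => [<-|ne].
    have k3 : cod (rpush_arr e0) =
        dom (app2 (frho (edge P ord_max)) (sval z ord_max) y e).
      by rewrite cod_rpush_arr; symmetry; apply: dom_rho.
    have e4 : fq (edge P ord_max) mor
        (mcomp (rpush_arr e1) (sval z ord_max) k2) = ctgt (acell y).
      by rewrite -e2.
    rewrite upd_in; transitivity (rpull e4); first exact: app2_eq.
    by rewrite -(rho_square k3) ccE !upd_in.
  by rewrite !upd_out // ccfi // /S fib_mcomp fib_tup upd_out // ccif.
have eF : lsource f mor (tup h0) = idm (lsource f ob (dom z)).
  rewrite /= /p_first fp_upd; last by rewrite fp_rho.
  by rewrite /ids !fidm.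
rewrite (lcell_absorbr _ I0 eF) => ->; rewrite vcE rwhE lcell_comp_idl //.
have -> : ltarget g mor (tup h1) = g mor (acod y).
  by rewrite /= upd_in /q_last fq_rho.
by rewrite dom_comp.
Qed.

Lemma om_right_mor (z : fibprod P mor) (y : arr (vtx P n.+1) mor)
    (e : q_last P mor (sval z ord_max) = arr_src (vtx P n.+1) mor y) h e' :
  fun_of_lax_mor phi (@tup n P mor (upd (sval z)
      (app2 (frho (edge P ord_max)) (sval z ord_max) y e)) h) =
  @abar_mor C (fun_of_lax_mor phi z) (arrmap_mor g y) e'.
Proof.
have e0 : q_last P ob (sval (dom z) ord_max) = dom (adom y) := rho_dom_fit e.
have e1 : q_last P ob (sval (cod z) ord_max) = dom (acod y) := rho_cod_fit e.
have [[h0 [d0 E0]] _] := hom e0; have [[h1 [d1 E1]] _] := hom e1.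
apply: amor_eq.
- apply: etrans (etrans E0 _); last exact: comp_eq.
  congr lcomp; apply: fib_eq => m; rewrite ?tupE ?fibE.
  case: (eqVneq ord_max m) => [<-|ne]; last by rewrite !upd_out.
  by rewrite !upd_in; apply: dom_rho.
- apply: etrans (etrans E1 _); last exact: comp_eq.
  congr lcomp; apply: fib_eq => m; rewrite ?tupE ?fibE.
  case: (eqVneq ord_max m) => [<-|ne]; last by rewrite !upd_out.
  by rewrite !upd_in; apply: cod_rho.
- by rewrite /= /p_first fp_upd // fp_rho.
- by rewrite /= upd_in /q_last fq_rho.
- by rewrite abarE; apply: om_lcell.
Qed.

Lemma om_right k (z : fibprod P k) (y : arr (vtx P n.+1) k)
    (e : q_last P k (sval z ord_max) = arr_src (vtx P n.+1) k y) :
  exists h e',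
  T k (@tup n P k (upd (sval z)
    (app2 (frho (edge P ord_max)) (sval z ord_max) y e)) h) =
  app2 (arr_comp C) (T k z) (arrmap g k y) e'.
Proof.
have h l : glued l
    (upd (sval z) (app2 (frho (edge P ord_max)) (sval z ord_max) y e)).
  by apply: glued_last; [exact: (svalP z) | rewrite fp_rho].
have e' : arr_tgt C k (T k z) = arr_src C k (arrmap g k y).
  by rewrite arrmap_src -e fun_of_lax_tgt.
exists h, e'; case: k z y e h e' => z y e h e'.
- have [[h0 [d0 E0]] _] := hom e.
  by rewrite (proof_irrelevance _ h h0); apply: (etrans E0); apply: comp_eq.
- exact: om_right_mor.
- have es : q_last P mor (sval (csrc z) ord_max) =
      arr_src (vtx P n.+1) mor (csrc y) by rewrite -fcsrc -e fcsrc.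
  have et : q_last P mor (sval (ctgt z) ord_max) =
      arr_src (vtx P n.+1) mor (ctgt y) by rewrite -fctgt -e fctgt.
  have hs l : glued l
      (upd (sval (csrc z)) (app2 (frho (edge P ord_max)) _ (csrc y) es)).
    by apply: glued_last; [exact: (svalP (csrc z)) | rewrite fp_rho].
  have ht l : glued l
      (upd (sval (ctgt z)) (app2 (frho (edge P ord_max)) _ (ctgt y) et)).
    by apply: glued_last; [exact: (svalP (ctgt z)) | rewrite fp_rho].
  apply: acel_eq.
  + apply: etrans (om_right_mor hs _); congr fun_of_lax_mor; apply: fib_eq => m.
    rewrite ?tupE ?fibE.
    case: (eqVneq ord_max m) => [<-|ne]; last by rewrite !upd_out.
    by rewrite !upd_in; apply: app2_csrc.
  + apply: etrans (om_right_mor ht _); congr fun_of_lax_mor; apply: fib_eq => m.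
    rewrite ?tupE ?fibE.
    case: (eqVneq ord_max m) => [<-|ne]; last by rewrite !upd_out.
    by rewrite !upd_in; apply: app2_ctgt.
  + by rewrite /= /p_first fp_upd // fp_rho.
  + by rewrite /= upd_in /q_last fq_rho.
Qed.
End Right.

Section Middle.
Hypothesis him : im phi.
Variable l : 'I_n.

(** The tuples K = (..., rho(s_m,x), s_(m+1), ...) and
    L = (..., s_m, lambda(x,s_(m+1)), ...) are compared through the cleavage
    tuples c0 over u0 and c1 over u1.  With S_m = rho_q(j_m,u1) o s_m and
    S_(m+1) = s_(m+1) o lambda_p(u0,i_(m+1)), the factorisations give
    K o c0 = (..., zeta^* S_m, S_(m+1), ...) and
    c1 o L = (..., S_m, zeta_! S_(m+1), ...), whose naturality cells agree by
    (iec); and c0 and c1 can be cancelled by (im). *)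
Lemma im_mid_mor (s : ladder P mor) (x : arr (vtx P l.+1) mor)
    (e : q_lo P l mor (s (lo l)) = arr_src (vtx P l.+1) mor x)
    (e' : arr_tgt (vtx P l.+1) mor x = p_hi P l mor (s (hi l))) h h' :
  glued_off l s ->
  fun_of_lax_mor phi
    (@tup n P mor (upd s (app2 (frho (edge P (lo l))) (s (lo l)) x e)) h) =
  fun_of_lax_mor phi
    (@tup n P mor (upd s (app2 (flam (edge P (hi l))) x (s (hi l)) e')) h').
Proof.
move=> hs.
pose d : ladder P ob := fun m => dom (s m).
pose c : ladder P ob := fun m => cod (s m).
have hd : glued_off l d.
  by move=> l' ne; rewrite /glued /d -!fdom; congr dom; apply: hs.
have hc : glued_off l c.
  by move=> l' ne; rewrite /glued /c -!fcod; congr cod; apply: hs.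
have d0 : q_lo P l ob (d (lo l)) = dom (adom x) := rho_dom_fit e.
have d1 : q_lo P l ob (c (lo l)) = dom (acod x) := rho_cod_fit e.
have d0' : cod (adom x) = p_hi P l ob (d (hi l)) := lam_dom_fit e'.
have d1' : cod (acod x) = p_hi P l ob (c (hi l)) := lam_cod_fit e'.
have [[h0 [h0' E0]] [g0 I0]] := him d0 d0' hd.
have [[h1 [h1' E1]] [g1 I1]] := him d1 d1' hc.
have k0 : cod (tup g0) = dom (tup h).
  apply: fib_eq => m; rewrite ?tupE ?fibE.
  case: (eqVneq (hi l) m) => [<-|ne].
    by rewrite upd_in cod_lpull_arr upd_out // lo_neq_hi.
  rewrite upd_out //; case: (eqVneq (lo l) m) => [<-|ne'].
    by rewrite !upd_in cod_rpush_arr; symmetry; apply: dom_rho.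
  by rewrite !upd_out // cod_idm.
have k1 : cod (tup h') = dom (tup g1).
  apply: fib_eq => m; rewrite ?tupE ?fibE.
  case: (eqVneq (hi l) m) => [<-|ne].
    by rewrite !upd_in dom_lpull_arr; apply: cod_lam.
  rewrite !(upd_out _ _ ne); case: (eqVneq (lo l) m) => [<-|ne'].
    by rewrite upd_in dom_rpush_arr.
  by rewrite upd_out // dom_idm.
have k2 : cod (s (lo l)) = dom (rpush_arr d1) by rewrite dom_rpush_arr.
have k3 : cod (lpull_arr d0') = dom (s (hi l)) by rewrite cod_lpull_arr.
pose Slo := mcomp (rpush_arr d1) (s (lo l)) k2.
pose Shi := mcomp (s (hi l)) (lpull_arr d0') k3.
pose S := upd (upd s Slo) Shi.
have eSlo : S (lo l) = Slo.
  by rewrite /S upd_out ?upd_in // eq_sym lo_neq_hi.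
have eShi : S (hi l) = Shi by rewrite /S upd_in.
have hS : glued_off l S.
  apply: glued_off_hi; first by apply: glued_off_lo => //; apply: fp_rpush_comp.
  by rewrite upd_out ?lo_neq_hi //; apply: fq_comp_lpull.
have e3 : csrc (acell x) = p_hi P l mor (S (hi l)).
  by rewrite eShi /p_hi /Shi fp_comp_lpull csrc_acellT [aright x]e'.
have e4 : q_lo P l mor (S (lo l)) = ctgt (acell x).
  by rewrite eSlo /q_lo /Slo fq_rpush_comp ctgt_acellT -[aleft x]e.
have [h3 [h3']] := @lax_iec _ _ _ _ _ phi l S (acell x) e3 e4 hS.
have -> : tup h3 = mcomp (tup h) (tup g0) k0.
  apply: fib_eq => m; rewrite ?tupE ?fibE.
  case: (eqVneq (hi l) m) => [<-|ne].
    rewrite upd_out ?lo_neq_hi // [in RHS]upd_out ?lo_neq_hi //.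
    by rewrite upd_in eShi /Shi ccE.
  rewrite (upd_out _ _ ne); case: (eqVneq (lo l) m) => [<-|ne'].
    have k4 : cod (rpush_arr d0) =
        dom (app2 (frho (edge P (lo l))) (s (lo l)) x e).
      by rewrite cod_rpush_arr; symmetry; apply: dom_rho.
    have e5 : fq (edge P (lo l)) mor Slo = ctgt (acell x) by rewrite -eSlo.
    rewrite upd_in; transitivity (rpull e5); first exact: app2_eq.
    by rewrite -(rho_square k4) ccE !upd_in.
  by rewrite /S !upd_out // ccfi.
have -> : tup h3' = mcomp (tup g1) (tup h') k1.
  apply: fib_eq => m; rewrite ?tupE ?fibE.
  case: (eqVneq (hi l) m) => [<-|ne].
    have k4 : cod (app2 (flam (edge P (hi l))) x (s (hi l)) e') =
        dom (lpull_arr d1') by rewrite dom_lpull_arr; apply: cod_lam.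
    have e5 : csrc (acell x) = fp (edge P (hi l)) mor Shi by rewrite -eShi.
    rewrite upd_in; transitivity (lpush e5); first exact: app2_eq.
    by rewrite -(lam_square k4) ccE !upd_in.
  rewrite !(upd_out _ _ ne); case: (eqVneq (lo l) m) => [<-|ne'].
    by rewrite eSlo /Slo upd_in ccE.
  by rewrite /S !upd_out // ccif.
have eF : lsource f mor (tup g0) = idm (lsource f ob (dom (tup h'))).
  rewrite /= /p_first upd_out //.
  rewrite fp_upd; last by rewrite fp_rho.
  by rewrite /ids fidm fidm /d upd_out.
have eG : ltarget g mor (tup g1) = idm (ltarget g ob (cod (tup h))).
  rewrite /= /q_last fq_upd; last by rewrite fq_lam upd_out // lo_neq_hi.
  rewrite upd_out; last by rewrite eq_sym lo_neq_max.
  rewrite /ids fidm fidm /c upd_out //.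
  by rewrite eq_sym lo_neq_max.
rewrite (lcell_absorbr _ I0 eF) (lcell_absorbl _ I1 eG) => Elc.
have ed : dom (tup h) = tup h0' /\ dom (tup h') = tup h0.
  split; apply: fib_eq => m; rewrite ?tupE ?fibE.
    case: (eqVneq (lo l) m) => [<-|ne]; last by rewrite !upd_out.
    by rewrite !upd_in; apply: dom_rho.
  case: (eqVneq (hi l) m) => [<-|ne]; last by rewrite !upd_out.
  by rewrite !upd_in; apply: dom_lam.
have ec : cod (tup h) = tup h1' /\ cod (tup h') = tup h1.
  split; apply: fib_eq => m; rewrite ?tupE ?fibE.
    case: (eqVneq (lo l) m) => [<-|ne]; last by rewrite !upd_out.
    by rewrite !upd_in; apply: cod_rho.
  case: (eqVneq (hi l) m) => [<-|ne]; last by rewrite !upd_out.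
  by rewrite !upd_in; apply: cod_lam.
apply: amor_eq => //.
- by case: ed => /(congr1 (lcomp phi)) E /(congr1 (lcomp phi)) E';
    apply: etrans E (etrans _ (esym E')).
- by case: ec => /(congr1 (lcomp phi)) E /(congr1 (lcomp phi)) E';
    apply: etrans E (etrans _ (esym E')).
- rewrite /= /p_first fp_upd ?fp_rho //.
  by rewrite upd_out.
- rewrite /= /q_last [in RHS]fq_upd ?fq_lam //.
  by rewrite upd_out // eq_sym lo_neq_max.
Qed.

Lemma im_mid k (s : ladder P k) (x : arr (vtx P l.+1) k)
    (e : q_lo P l k (s (lo l)) = arr_src (vtx P l.+1) k x)
    (e' : arr_tgt (vtx P l.+1) k x = p_hi P l k (s (hi l))) :
  glued_off l s ->
  exists h h',
  T k (@tup n P k (upd s (app2 (frho (edge P (lo l))) (s (lo l)) x e)) h) =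
  T k (@tup n P k (upd s (app2 (flam (edge P (hi l))) x (s (hi l)) e')) h').
Proof.
move=> hs.
have h k0 (s0 : ladder P k0) x0 (e0 : q_lo P l k0 (s0 (lo l)) = _) :
    arr_tgt (vtx P l.+1) k0 x0 = p_hi P l k0 (s0 (hi l)) -> glued_off l s0 ->
    forall l', glued l' (upd s0 (app2 (frho (edge P (lo l))) (s0 (lo l)) x0 e0)).
  by move=> e0' hs0; apply: glued_lo => //; rewrite /q_lo ?fq_rho // fp_rho.
have h' k0 (s0 : ladder P k0) x0 (e0 : _ = p_hi P l k0 (s0 (hi l))) :
    q_lo P l k0 (s0 (lo l)) = arr_src (vtx P l.+1) k0 x0 -> glued_off l s0 ->
    forall l', glued l' (upd s0 (app2 (flam (edge P (hi l))) x0 (s0 (hi l)) e0)).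
  by move=> e0' hs0; apply: glued_hi => //; rewrite /p_hi ?fp_lam // fq_lam.
exists (h _ _ _ e e' hs), (h' _ _ _ e' e hs).
case: k s x e e' hs => s x e e' hs.
- have [[h0 [h0' E0]] _] := him e e' hs.
  apply: (etrans _ (etrans (esym E0) _)); congr lcomp; exact: fib_eq.
- exact: im_mid_mor.
- have es : q_lo P l mor (csrc (s (lo l))) =
      arr_src (vtx P l.+1) mor (csrc x) by rewrite -!fcsrc e.
  have et : q_lo P l mor (ctgt (s (lo l))) =
      arr_src (vtx P l.+1) mor (ctgt x) by rewrite -!fctgt e.
  have es' : arr_tgt (vtx P l.+1) mor (csrc x) =
      p_hi P l mor (csrc (s (hi l))) by rewrite -!fcsrc e'.
  have et' : arr_tgt (vtx P l.+1) mor (ctgt x) =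
      p_hi P l mor (ctgt (s (hi l))) by rewrite -!fctgt e'.
  have hss : @glued_off n P l mor (fun m => csrc (s m)).
    by move=> l' ne; rewrite /glued -!fcsrc; congr csrc; apply: hs.
  have hst : @glued_off n P l mor (fun m => ctgt (s m)).
    by move=> l' ne; rewrite /glued -!fctgt; congr ctgt; apply: hs.
  apply: acel_eq.
  + have im_csrc := im_mid_mor (h mor (fun m => csrc (s m)) (csrc x) es es' hss)
      (h' mor (fun m => csrc (s m)) (csrc x) es' es hss) hss.
    apply: etrans (etrans im_csrc _); congr fun_of_lax_mor; apply: fib_eq => m;
      rewrite ?tupE ?fibE.
    * case: (eqVneq (lo l) m) => [<-|ne]; last by rewrite !upd_out.
      by rewrite !upd_in; apply: app2_csrc.
    * case: (eqVneq (hi l) m) => [<-|ne]; last by rewrite !upd_out.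
      by rewrite !upd_in; symmetry; apply: app2_csrc.
  + have im_ctgt := im_mid_mor (h mor (fun m => ctgt (s m)) (ctgt x) et et' hst)
      (h' mor (fun m => ctgt (s m)) (ctgt x) et' et hst) hst.
    apply: etrans (etrans im_ctgt _); congr fun_of_lax_mor; apply: fib_eq => m;
      rewrite ?tupE ?fibE.
    * case: (eqVneq (lo l) m) => [<-|ne]; last by rewrite !upd_out.
      by rewrite !upd_in; apply: app2_ctgt.
    * case: (eqVneq (hi l) m) => [<-|ne]; last by rewrite !upd_out.
      by rewrite !upd_in; symmetry; apply: app2_ctgt.
  + rewrite /= /p_first fp_upd ?fp_rho //.
    by rewrite upd_out.
  + rewrite /= /q_last [in RHS]fq_upd ?fq_lam //.
    by rewrite upd_out // eq_sym lo_neq_max.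
Qed.

End Middle.
End Construction.

(** * The correspondence *)

Section Bijection.
Variables (n : nat) (P : fibpath n) (C : twocat).
Variables (f : twofun (vtx P 0) C) (g : twofun (vtx P n.+1) C).

Definition nullary_of_lax (phi : laxnat (lsource f) (ltarget g))
    (hcm : cm phi) (him : im phi) (hom : om phi) : nullary_cell f g :=
  NullaryCell (@fun_of_lax_src _ _ _ _ phi) (@fun_of_lax_tgt _ _ _ _ phi)
    (fun k x z e => cm_left hcm e) (fun k z y e => om_right hom e)
    (fun l k s x e e' hs => im_mid him e e' hs).

Lemma nullary_bij : bij_onto (@lax_of_nullary n P C f g)
  (fun phi : laxnat (lsource f) (ltarget g) => cm phi /\ im phi /\ om phi).
Proof.
split=> [N|phi [hcm [him hom]]].
  split; [exact: nullary_cm | split; [exact: nullary_im | exact: nullary_om]].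
have eN : lax_of_nullary (nullary_of_lax hcm him hom) = phi.
  exact: laxnat_eq.
exists (nullary_of_lax hcm him hom); split=> // N' eN'.
apply: nullary_eq.
exact: (lax_of_fun_inj (etrans eN (esym eN'))).
Qed.
End Bijection.

Theorem corollary7p11 (n : nat) (P : fibpath n) (C : twocat)
    (f : twofun (vtx P 0) C) (g : twofun (vtx P n.+1) C) :
  (forall phi : laxnat (lsource f) (ltarget g), poc phi /\ iec phi /\ pcc phi)
  /\ bij_onto (@lax_of_nullary n P C f g)
       (fun phi : laxnat (lsource f) (ltarget g) => cm phi /\ im phi /\ om phi)
  /\ (forall ld : forall m, locally_discrete (edge P m),
      bij_onto (@lax_of_ldnullary n (LdFibPath ld) C f g)
       (fun phi : laxnat (lsource f) (ltarget g) => cm phi /\ im phi /\ om phi)).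
Proof.
split=> [phi|]; last by split=> [|ld]; exact: nullary_bij.
by split; [exact: lax_poc | split; [exact: lax_iec | exact: lax_pcc]].
Qed.
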